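(* Let $X,0\subset\mathbb C^{k+n},0$ be the germ of an equidimensional complex analytic set with reduced structure, containing $Y=\mathbb C^k\times 0$, and let $X_0$ be the set of smooth points of $X$. Assume the pair $(X_0,Y)$ satisfies condition W at $0$. Suppose $H$ is a hyperplane containing $Y$ which is W-generic for $(X_0,Y)$. Then $(X_0\cap H,Y)$ satisfies condition W at $0$.
   Context: Coordinates on $\mathbb C^{k+n}=\mathbb C^k\times\mathbb C^n$ are $(y,z)=(y_1,\dots,y_k,z_1,\dots,z_n)$. Hyperplanes are linear; those containing $Y$ are parametrized by a projective space $\hat{\mathbb P}^{n-1}$. Condition W (Verdier): for linear subspaces $A,B$ put $\operatorname{dist}(A,B)=\sup |\langle u,v\rangle|/(\|u\|\|v\|)$ over nonzero $v\in A$, $u\in B^\perp$. A pair $(S,T)$ of complex submanifolds (near $t_0$) satisfies W at a point $t_0\in T$ if there are a neighborhood $U$ of $t_0$ and $C>0$ with $\operatorname{dist}(T_tT,T_sS)\le C\|s-t\|$ for all $s\in S\cap U$, $t\in T\cap U$ (in local coordinates). Condition W for $(S,T)$ presupposes that $S$ is smooth near $t_0$. W-generic hyperplane: let $\widetilde{\mathbb C^k\times\mathbb C^n}=\{((y,z),H)\in \mathbb C^k\times\mathbb C^n\times\hat{\mathbb P}^{n-1} : (y,z)\in H\}$, let $\beta$ be its projection to $\mathbb C^k\times\mathbb C^n$, let $\widetilde X=\beta^{-1}(X)$, and let $\widetilde X_0$ be the set of smooth points of $\widetilde X$ (as a reduced space). Note $Y\times\hat{\mathbb P}^{n-1}\subset\widetilde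 X$. $H$ is W-generic for $(X_0,Y)$ if the pair $(\widetilde X_0, Y\times\hat{\mathbb P}^{n-1})$ satisfies condition W at $(0,H)$. *)

(* Defs.v *)
From HB Require Import structures.
From mathcomp Require Import all_boot all_order all_algebra.
From mathcomp Require Import complex.
From mathcomp Require Import all_classical all_reals all_analysis.

Set Implicit Arguments.
Unset Strict Implicit.
Unset Printing Implicit Defensive.

Import Order.TTheory GRing.Theory Num.Theory numFieldNormedType.Exports.

Local Open Scope classical_set_scope.
Local Open Scope ring_scope.
Local Open Scope complex_scope.

(* [R[i]] as a normed module over itself, through its norm as a numeric field. *)
HB.instance Definition _ (R : realType) := GRing.ComAlgebra.copy R[i] R[i]^o.
HB.instance Definition _ (R : realType) := Vector.copy R[i] R[i]^o.
HB.instance Definition _ (R : realType) := NormedModule.copy R[i] R[i]^o.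

Section Defs.
Variable R : realType.

Section HermitianSpace.
Variable N : nat.
Implicit Types u v : 'rV[R[i]]_N.

Definition hdot u v : R[i] := \sum_j u 0 j * (v 0 j)^*.

(* The library norm on row vectors is the sup norm; this is the Hermitian norm,
   with values in [R]. *)
Definition hnorm v : R := Num.sqrt (\sum_j ComplexField.Normc.normc (v 0 j) ^+ 2).

(* When [A] or the orthogonal complement of [B] is trivial, the set below is
   empty, and its supremum is then [0]. *)
Definition dist (A B : {vspace 'rV[R[i]]_N}) : R :=
  sup [set r | exists u v, [/\ u \in A, u != 0, v != 0,
                 forall b, b \in B -> hdot b v = 0
               & r = ComplexField.Normc.normc (hdot u v) / (hnorm u * hnorm v)]].

End HermitianSpace.

Section LocalAnalyticGeometry.
Variable N : nat.
Local Notation V := 'rV[R[i]]_N.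
Implicit Types (S T X U : set V) (p q : V).

(* Holomorphic on an open set: complex differentiable with continuous complex
   derivative. *)
Definition holomorphic_on U m (f : V -> 'rV[R[i]]_m) : Prop :=
  forall p, U p -> differentiable f p /\ {for p, continuous (jacobian f)}.

Definition analytic_subset (Omega : set V) X : Prop :=
  X `<=` Omega /\
  forall p, Omega p -> exists U m (f : V -> 'rV[R[i]]_m),
    [/\ open U, U p, holomorphic_on U f & forall x, U x -> (X x <-> f x = 0)].

(* Near its point [p], [S] is a complex submanifold, cut out by the [m]
   components of [f], whose differentials at [p] are independent. *)
Definition submersive_equations S p m (f : V -> 'rV[R[i]]_m) : Prop :=
  S p /\ exists U,
    [/\ open U, U p, holomorphic_on U f, forall x, U x -> (S x <-> f x = 0)
      & \rank ('J f p) = m].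

Definition smooth_points_of_dim S (d : nat) : set V :=
  [set p | exists m (f : V -> 'rV[R[i]]_m),
             (m + d)%N = N /\ submersive_equations S p f].

(* The dimension is allowed to vary from point to point. *)
Definition smooth_points S : set V :=
  [set p | exists d, smooth_points_of_dim S d p].

Definition tangent_space S p (A : {vspace V}) : Prop :=
  exists m (f : V -> 'rV[R[i]]_m), submersive_equations S p f /\
    forall v, v \in A <-> 'd f p v = 0.

(* [dim_p X = d]: the upper limit at [p] of the dimension of [X] at its smooth
   points. *)
Definition local_dim X p (d : nat) : Prop :=
  closure (smooth_points_of_dim X d) p /\
  \forall q \near p, forall e, smooth_points_of_dim X e q -> (e <= d)%N.

Definition equidimensional_germ X p : Prop :=
  exists d, \forall q \near p, X q -> local_dim X q d.

Definition condition_W S T t0 : Prop :=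
  T t0 /\ exists2 U, nbhs t0 U & exists2 C : R, 0 < C &
    [/\ forall s, (S `&` U) s -> smooth_points S s,
        forall t, (T `&` U) t -> smooth_points T t
      & forall s t (A B : {vspace V}), (S `&` U) s -> (T `&` U) t ->
          tangent_space T t A -> tangent_space S s B ->
          dist A B <= C * hnorm (s - t)].

End LocalAnalyticGeometry.

Section Hyperplanes.
Variables k n : nat.
Local Notation V := 'rV[R[i]]_(k + n).

Definition Yspace : set V := [set x | rsubmx x = 0].

(* The dual projective space of hyperplanes containing [Yspace], a hyperplane
   being a linear subspace of codimension one. *)
Definition dualP : set {vspace V} :=
  [set H | (\dim H).+1 = (k + n)%N /\ Yspace `<=` [set` H]].

(* Standard affine charts: [w] is sent to the hyperplane [z_i + sum_(j != i)
   w_j z_j = 0], the [n.-1] coordinates [w_j] being indexed through [lift i]. *)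
Definition chart_form (i : 'I_n) (w : 'rV[R[i]]_n.-1) : 'rV[R[i]]_n :=
  \row_j (if unlift i j is Some l then w 0 l else 1).

Definition chart_hyperplane (i : 'I_n) (w : 'rV[R[i]]_n.-1) : {vspace V} :=
  lker (linfun (mulmxr (col_mx 0 (chart_form i w)^T) : V -> 'rV[R[i]]_1)).

Definition chart (i : 'I_n) (p : 'rV[R[i]]_(k + n + n.-1)) : V * {vspace V} :=
  (lsubmx p, chart_hyperplane i (rsubmx p)).

Implicit Types (S T : set (V * {vspace V})).

Definition smooth_points_P S : set (V * {vspace V}) :=
  [set q | exists i p, chart i p = q /\ smooth_points (chart i @^-1` S) p].

Definition condition_W_P S T (q : V * {vspace V}) : Prop :=
  exists i p, chart i p = q /\
    condition_W (chart i @^-1` S) (chart i @^-1` T) p.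

Definition incidence : set (V * {vspace V}) :=
  [set q | dualP q.2 /\ q.1 \in q.2].

Definition Xtilde (X : set V) : set (V * {vspace V}) :=
  incidence `&` (fst @^-1` X).

Definition W_generic (X : set V) (H : {vspace V}) : Prop :=
  condition_W_P (smooth_points_P (Xtilde X)) (Yspace `*` dualP) (0, H).

End Hyperplanes.

End Defs.

Arguments Yspace : clear implicits.
Arguments dualP : clear implicits.

(* Main.v *)
(* Put [s = (x, w)] with [x] a smooth point of [X] off [Y] lying on the hyperplane
   [l_w = 0], and [z'] the coordinates of [x] multiplying [w] in [l_w].  If [X] is
   [g = 0] near [x], the conormals of the incidence variety at [s] are the vectors
   [(c, b z')] with [c = a dg + b l_w].  Comparing [s] with [(y, 0, w)], W-genericity
   says that the [Y] and [w] components of a conormal are at most a multiple of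
   [|z| |(c, b z')|].  As [|z|] is at most a multiple of [|z'|], the [w] component gives
   [|b| <= C |c|]: the hyperplane is uniformly transverse to [X] off [Y].  The [Y]
   component then gives [|c_Y| <= C' |z| |c|], which is condition W for the section,
   whose conormals are exactly the [c] with [w] fixed.
   At a smooth point [s] of [X] on [Y] only the smoothness of the section is at stake.
   If the hyperplane contains [T_s X] and [T_s X] is not [Y], the hyperplane can be
   tilted to meet [X] off [Y] near [s], and the limit of [|b| <= C |c|] is violated;
   if [T_s X = Y] then [X = Y] near [s].
   Tangent spaces do not depend on the equations because the kernel of the
   differential of submersive equations consists of limits of secants (Newton's method). *)

Require Import Defs.
From HB Require Import structures.
From mathcomp Require Import all_boot all_order all_algebra.
From mathcomp Require Import complex.
From mathcomp Require Import all_classical all_reals all_analysis.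
From mathcomp Require Import ring lra.

Set Implicit Arguments.
Unset Strict Implicit.
Unset Printing Implicit Defensive.

Import Order.TTheory GRing.Theory Num.Theory numFieldNormedType.Exports.

Local Open Scope classical_set_scope.
Local Open Scope ring_scope.
Local Open Scope complex_scope.

Local Notation normc := ComplexField.Normc.normc.
Local Notation Re := complex.Re.
Local Notation Im := complex.Im.

(** * The entrywise sum norm, and the library's topology and differential expressed in it *)

Section L1Norm.
Variable R : realType.

Lemma normc_ge0 (x : R[i]) : 0 <= normc x.
Proof. by case: x => a b; rewrite /ComplexField.Normc.normc sqrtr_ge0. Qed.

Lemma normrC (x : R[i]) : `|x| = (normc x)%:C.
Proof. by []. Qed.

Lemma normc_conj (x : R[i]) : normc x^* = normc x.
Proof. by case: x => a b /=; rewrite sqrrN. Qed.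

Lemma normc_real (x : R) : normc x%:C = `|x|.
Proof. by rewrite /= expr0n addr0 sqrtr_sqr. Qed.

(** The library norm on complex matrices is a sup norm with values in [R[i]]. This one is real,
    submultiplicative, additive over blocks and invariant under transposition, so all estimates can
    be left to linear arithmetic over [R]. *)
Definition l1norm m n (A : 'M[R[i]]_(m, n)) : R := \sum_i \sum_j normc (A i j).

Lemma l1norm_ge0 m n (A : 'M[R[i]]_(m, n)) : 0 <= l1norm A.
Proof. by apply: sumr_ge0 => i _; apply: sumr_ge0 => j _; exact: normc_ge0. Qed.

Lemma normc_le_l1norm m n (A : 'M[R[i]]_(m, n)) i j : normc (A i j) <= l1norm A.
Proof.
rewrite /l1norm (bigD1 i)//= (bigD1 j)//= -addrA lerDl addr_ge0 //.
  by apply: sumr_ge0 => l _; exact: normc_ge0.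
by apply: sumr_ge0 => l _; apply: sumr_ge0 => l' _; exact: normc_ge0.
Qed.

Lemma l1norm0 m n : l1norm (0 : 'M[R[i]]_(m, n)) = 0.
Proof.
by apply: big1 => i _; apply: big1 => j _; rewrite mxE ComplexField.Normc.normc0.
Qed.

Lemma l1norm_eq0 m n (A : 'M[R[i]]_(m, n)) : l1norm A = 0 -> A = 0.
Proof.
move=> A0; apply/matrixP => i j; rewrite mxE.
apply: ComplexField.Normc.eq0_normc; apply/eqP.
by rewrite eq_le normc_ge0 andbT -A0 normc_le_l1norm.
Qed.

Lemma l1norm_gt0 m n (A : 'M[R[i]]_(m, n)) : A != 0 -> 0 < l1norm A.
Proof.
move=> A0; rewrite lt_def l1norm_ge0 andbT.
by apply: contra A0 => /eqP/l1norm_eq0/eqP.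
Qed.

Lemma l1normD m n (A B : 'M[R[i]]_(m, n)) : l1norm (A + B) <= l1norm A + l1norm B.
Proof.
rewrite /l1norm -big_split; apply: ler_sum => i _ /=.
rewrite -big_split; apply: ler_sum => j _ /=; rewrite mxE.
exact: le_normcD.
Qed.

Lemma l1normN m n (A : 'M[R[i]]_(m, n)) : l1norm (- A) = l1norm A.
Proof.
apply: eq_bigr => i _; apply: eq_bigr => j _.
by rewrite mxE normcN.
Qed.

Lemma l1normBC m n (A B : 'M[R[i]]_(m, n)) : l1norm (A - B) = l1norm (B - A).
Proof. by rewrite -l1normN opprB. Qed.

Lemma l1normB m n (A B C : 'M[R[i]]_(m, n)) :
  l1norm (A - C) <= l1norm (A - B) + l1norm (B - C).
Proof. by apply: le_trans (l1normD _ _); rewrite addrA subrK. Qed.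

Lemma l1normZ m n (a : R[i]) (A : 'M[R[i]]_(m, n)) :
  l1norm (a *: A) = normc a * l1norm A.
Proof.
rewrite /l1norm mulr_sumr; apply: eq_bigr => i _.
rewrite mulr_sumr; apply: eq_bigr => j _.
by rewrite mxE ComplexField.Normc.normcM.
Qed.

Lemma l1norm_tr m n (A : 'M[R[i]]_(m, n)) : l1norm A^T = l1norm A.
Proof.
rewrite /l1norm exchange_big; apply: eq_bigr => i _; apply: eq_bigr => j _.
by rewrite mxE.
Qed.

Lemma l1norm_row_mx m n1 n2 (A : 'M[R[i]]_(m, n1)) (B : 'M[R[i]]_(m, n2)) :
  l1norm (row_mx A B) = l1norm A + l1norm B.
Proof.
rewrite /l1norm -big_split; apply: eq_bigr => i _ /=; rewrite big_split_ord.
by congr (_ + _); apply: eq_bigr => j _; rewrite ?row_mxEl ?row_mxEr.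
Qed.

Lemma l1norm_col_mx m1 m2 n (A : 'M[R[i]]_(m1, n)) (B : 'M[R[i]]_(m2, n)) :
  l1norm (col_mx A B) = l1norm A + l1norm B.
Proof. by rewrite -l1norm_tr tr_col_mx l1norm_row_mx !l1norm_tr. Qed.

Lemma l1norm_split m n1 n2 (A : 'M[R[i]]_(m, n1 + n2)) :
  l1norm A = l1norm (lsubmx A) + l1norm (rsubmx A).
Proof. by rewrite -{1}(hsubmxK A) l1norm_row_mx. Qed.

Lemma le_normc_sum (I : Type) (r : seq I) (F : I -> R[i]) :
  normc (\sum_(i <- r) F i) <= \sum_(i <- r) normc (F i).
Proof.
elim/big_ind2: _ => [|x1 x2 y1 y2 h1 h2|//].
- by rewrite ComplexField.Normc.normc0.
- exact: le_trans (le_normcD _ _) (lerD h1 h2).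
Qed.

Lemma l1normM m n p (A : 'M[R[i]]_(m, n)) (B : 'M[R[i]]_(n, p)) :
  l1norm (A *m B) <= l1norm A * l1norm B.
Proof.
rewrite {1}/l1norm; apply: (@le_trans _ _
  (\sum_i \sum_k \sum_j normc (A i j) * normc (B j k))).
  apply: ler_sum => i _; apply: ler_sum => k _; rewrite mxE.
  apply: le_trans (le_normc_sum _ _) _.
  by apply: ler_sum => j _; rewrite ComplexField.Normc.normcM.
rewrite {1}/l1norm mulr_suml; apply: ler_sum => i _.
rewrite exchange_big mulr_suml; apply: ler_sum => j _ /=.
rewrite -mulr_sumr; apply: ler_wpM2l; first exact: normc_ge0.
rewrite /l1norm (bigD1 j)//= lerDl.
by apply: sumr_ge0 => l _; apply: sumr_ge0 => l' _; exact: normc_ge0.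
Qed.

Lemma entry_le_norm m n (A : 'M[R[i]]_(m, n)) i j : `|A i j| <= `|A|.
Proof. rewrite [leRHS]mx_normE -[leLHS]nngE num_le; exact: (le_bigmax _ _ (i, j)). Qed.

Lemma norm_le_l1norm m n (A : 'M[R[i]]_(m, n)) : `|A| <= (l1norm A)%:C.
Proof.
have [A0|/mx_norm_neq0[[i j] /= Aij]] := eqVneq (mx_norm A) 0.
  by rewrite [leLHS]A0 ler0c l1norm_ge0.
by rewrite [leLHS]Aij normrC lecR normc_le_l1norm.
Qed.

Lemma l1norm_le_norm m n (A : 'M[R[i]]_(m, n)) :
  (l1norm A)%:C <= (m * n)%:R * `|A|.
Proof.
rewrite /l1norm rmorph_sum; under eq_bigr do rewrite rmorph_sum.
apply: (@le_trans _ _ (\sum_(i < m) \sum_(j < n) `|A|)).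
  by apply: ler_sum => i _; apply: ler_sum => j _; exact: entry_le_norm.
by rewrite !sumr_const !card_ord -mulrnA mulr_natl mulnC.
Qed.

Lemma RRe_gt0 (e : R[i]) : 0 < e -> (Re e)%:C = e.
Proof. by move=> e0; rewrite RRe_real ?gtr0_real. Qed.

Lemma gt0_ReC (e : R[i]) : 0 < e -> 0 < Re e.
Proof. by move=> e0; rewrite -ltcR RRe_gt0. Qed.

Lemma nbhs_l1normP m n (p : 'M[R[i]]_(m, n)) (U : set 'M[R[i]]_(m, n)) :
  nbhs p U <-> exists2 e : R, 0 < e & forall x, l1norm (x - p) < e -> U x.
Proof.
split=> [/nbhs_ballP[e /= e0 eU]|[e e0 eU]].
  exists (Re e); first exact: gt0_ReC.
  move=> x xe; apply: eU; rewrite mx_norm_ball /ball_ /= distrC.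
  by apply: le_lt_trans (norm_le_l1norm _) _; rewrite -(RRe_gt0 e0) ltcR.
(* The two norms differ by a factor of at most [m * n]; the successor keeps the denominator nonzero
   for empty matrices. *)
apply/nbhs_ballP; exists (e%:C / (m * n).+1%:R) => /=.
  by rewrite divr_gt0 ?ltr0n// ltcR.
move=> x; rewrite mx_norm_ball /ball_ /= distrC => xe; apply: eU.
rewrite -ltcR; apply: le_lt_trans (l1norm_le_norm _) _.
rewrite ltr_pdivlMr ?ltr0n// mulrC in xe.
by apply: le_lt_trans xe; rewrite ler_wpM2r ?ler_nat.
Qed.

Lemma continuous_l1normP m n m' n' (f : 'M[R[i]]_(m, n) -> 'M[R[i]]_(m', n')) p :
  {for p, continuous f} <-> forall e : R, 0 < e -> exists2 d : R, 0 < d &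
    forall x, l1norm (x - p) < d -> l1norm (f x - f p) < e.
Proof.
split=> [fc e e0|fP U /nbhs_l1normP[e e0 eU]].
  have /fc/nbhs_l1normP : nbhs (f p) [set y | l1norm (y - f p) < e].
    by apply/nbhs_l1normP; exists e.
  by [].
apply/nbhs_l1normP; have [d d0 dP] := fP e e0; exists d => // x /dP xe.
exact: eU.
Qed.

Lemma mulmxr_continuous m n (J : 'M[R[i]]_(m, n)) :
  continuous (mulmxr J : 'rV[R[i]]_m -> 'rV[R[i]]_n).
Proof.
move=> p; apply/continuous_l1normP => e e0.
exists (e / (l1norm J + 1)) => [|x].
  by rewrite divr_gt0// ltr_wpDl ?l1norm_ge0.
have J1 : 0 < l1norm J + 1 by rewrite ltr_wpDl ?l1norm_ge0.
rewrite ltr_pdivlMr//= -mulmxBl; apply: le_lt_trans; apply: le_trans (l1normM _ _) _.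
by rewrite ler_wpM2l ?l1norm_ge0// lerDl.
Qed.

(** Fréchet differentiability in epsilon-delta form. Vectors are rows, so [J] acts on the right and
    its columns are the differentials of the components of [f]. *)
Definition has_diff m n (f : 'rV[R[i]]_m -> 'rV[R[i]]_n) (p : 'rV[R[i]]_m)
    (J : 'M[R[i]]_(m, n)) :=
  forall e : R, 0 < e -> exists2 d : R, 0 < d & forall h, l1norm h < d ->
    l1norm (f (p + h) - f p - h *m J) <= e * l1norm h.

Lemma littleo_l1normP m n (g : 'rV[R[i]]_m -> 'rV[R[i]]_n) :
  (forall e : R[i], 0 < e -> \forall x \near (0 : 'rV[R[i]]_m), `|g x| <= e * `|x|) <->
  forall e : R, 0 < e -> exists2 d : R, 0 < d &
    forall h, l1norm h < d -> l1norm (g h) <= e * l1norm h.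
Proof.
split=> gP e e0.
  have e'0 : 0 < (e / (1 * n).+1%:R)%:C by rewrite ltcR divr_gt0// ltr0n.
  have /nbhs_l1normP[d d0 dP] := gP _ e'0; exists d => // h hd.
  have /dP : l1norm (h - 0) < d by rewrite subr0.
  move=> gh; rewrite -lecR; apply: le_trans (l1norm_le_norm _) _.
  apply: (@le_trans _ _ ((1 * n).+1%:R * `|g h|)); first by rewrite ler_wpM2r ?ler_nat.
  rewrite mulrC -ler_pdivlMr ?ltr0n//; apply: le_trans gh _.
  have -> : (e / (1 * n).+1%:R)%:C = e%:C / (1 * n).+1%:R :> R[i].
    by rewrite rmorphM /= fmorphV rmorph_nat.
  rewrite rmorphM /= mulrAC ler_wpM2r ?invr_ge0 ?ler0n//.
  by rewrite ler_wpM2l ?norm_le_l1norm// lecR ltW.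
have e'0 : 0 < Re e / (1 * m).+1%:R by rewrite divr_gt0 ?gt0_ReC// ltr0n.
have [d d0 dP] := gP _ e'0; apply/nbhs_l1normP; exists d => // h.
rewrite subr0 => /dP gh; apply: le_trans (norm_le_l1norm _) _.
rewrite -lecR in gh; apply: le_trans gh _.
rewrite !rmorphM /= fmorphV rmorph_nat RRe_gt0// -mulrA ler_wpM2l ?(ltW e0)//.
rewrite mulrC ler_pdivrMr ?ltr0n// mulrC; apply: le_trans (l1norm_le_norm _) _.
by rewrite ler_wpM2r ?ler_nat.
Qed.

Lemma differentiable_has_diff m n (f : 'rV[R[i]]_m -> 'rV[R[i]]_n) p :
  differentiable f p -> has_diff f p ('J f p).
Proof.
move=> /diff_locallyP[_ /eqaddoP/littleo_l1normP fP] e /fP[d d0 dP].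
exists d => // h /dP; rewrite mul_rV_lin1 /=.
by rewrite !fctE /= /shift opprD addrA [h + p]addrC.
Qed.

Lemma has_diff_diff m n (f : 'rV[R[i]]_m -> 'rV[R[i]]_n) p J :
  has_diff f p J -> differentiable f (p : 'rV[R[i]]_m) /\ 'd f p = mulmxr J :> (_ -> _).
Proof.
move=> fJ.
pose L : {linear 'rV[R[i]]_m -> 'rV[R[i]]_n} := mulmxr J.
have Lc : continuous L by exact: mulmxr_continuous.
have fo : forall e : R, 0 < e -> exists2 d : R, 0 < d & forall h, l1norm h < d ->
    l1norm ((f \o shift p - (cst (f p) + L)) h) <= e * l1norm h.
  move=> e /fJ[d d0 dP]; exists d => // h hd.
  have -> : (f \o shift p - (cst (f p) + L)) h = f (p + h) - f p - h *m J.
    by rewrite !fctE opprD addrA /= [h + p]addrC.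
  exact: dP.
move/littleo_l1normP in fo.
have dE : 'd f p = L :> (_ -> _) by apply: diff_unique => //; apply/eqaddoP.
split; last exact: dE.
by apply/diff_locallyP; split; rewrite dE//; apply/eqaddoP.
Qed.

Lemma has_diff_jacobian m n (f : 'rV[R[i]]_m -> 'rV[R[i]]_n) p J :
  has_diff f p J -> 'J f p = J.
Proof.
move=> /has_diff_diff[_ dE]; apply/row_matrixP => i.
by rewrite !rowE mul_rV_lin1 /= dE.
Qed.

Lemma diff_jacobianE m n (f : 'rV[R[i]]_m -> 'rV[R[i]]_n) p h :
  differentiable f p -> 'd f p h = h *m 'J f p.
Proof. by move=> df; rewrite mul_rV_lin1. Qed.

End L1Norm.

(** * Strict differentiability of holomorphic maps *)

Lemma segment_affine (K : comPzRingType) n (a : K) (x y p : 'rV[K]_n) :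
  y + a *: (x - y) - p = a *: (x - p) + (1 - a) *: (y - p).
Proof. by apply/rowP => j; rewrite !mxE; ring. Qed.

Lemma increment_split (K : comPzRingType) n (s t : K) (a b c u v : 'rV[K]_n) :
  a - c - s *: v - (b - c - t *: v) = a - b - (s - t) *: u + (s - t) *: (u - v).
Proof. by apply/rowP => j; rewrite !mxE; ring. Qed.

Section StrictDifferentiability.
Variable R : realType.

(** A mean value inequality without derivatives: the set of times up to which the bound from 0 holds
    contains its supremum, and the local estimate there would push it further if the supremum were
    below 1. *)
Lemma local_to_global_lipschitz n (phi : R -> 'rV[R[i]]_n) (K : R) : 0 <= K ->
  (forall t, 0 <= t <= 1 -> exists2 d, 0 < d & forall s, `|s - t| < d ->
    l1norm (phi s - phi t) <= K * `|s - t|) ->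
  l1norm (phi 1 - phi 0) <= K.
Proof.
move=> K0 phiP.
pose E := [set t : R | 0 <= t <= 1 /\ l1norm (phi t - phi 0) <= K * t].
have E0 : E 0 by split; rewrite ?lexx ?ler01// subrr l1norm0 mulr0.
have E1 : ubound E 1 by move=> t [/andP[]].
have supE : has_sup E by split; [exists 0|exists 1].
have c01 : 0 <= sup E <= 1.
  by apply/andP; split; [exact: ub_le_sup supE.2 _ E0|exact: ge_sup supE.1 E1].
have [d d0 dP] := phiP _ c01.
have [t Et ct] := sup_adherent d0 supE.
have tc : t <= sup E by exact: ub_le_sup supE.2 _ Et.
have Ec : E (sup E).
  split=> //; apply: le_trans (l1normB _ (phi t) _) _.
  have -> : K * sup E = K * (sup E - t) + K * t by rewrite -mulrDr subrK.
  apply: lerD; last exact: Et.2.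
  rewrite l1normBC; apply: le_trans (dP t _) _.
    by rewrite ltr_norml; apply/andP; split; lra.
  by rewrite distrC ger0_norm ?subr_ge0.
have [c1|c1] := ltP (sup E) 1; last first.
  have -> : K = K * sup E.
    by have -> : sup E = 1 by [lra]; rewrite mulr1.
  have -> : 1 = sup E by lra.
  exact: Ec.2.
(* Below 1, the local estimate at [sup E] puts a larger time into [E]. *)
pose s := Num.min 1 (sup E + d / 2).
have sc : sup E < s by rewrite lt_min c1 ltrDl divr_gt0.
have sd : s - sup E < d.
  have : s <= sup E + d / 2 by rewrite ge_min lexx orbT.
  lra.
have Es : E s.
  split; first by apply/andP; split; [lra|rewrite ge_min lexx].
  apply: le_trans (l1normB _ (phi (sup E)) _) _.
  have -> : K * s = K * (s - sup E) + K * sup E by rewrite -mulrDr subrK.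
  apply: lerD; last exact: Ec.2.
  apply: le_trans (dP s _) _; first by rewrite ltr_norml; apply/andP; split; lra.
  by rewrite ger0_norm// subr_ge0 ltW.
by have := ub_le_sup supE.2 Es; rewrite leNgt sc.
Qed.

Lemma l1norm_segment N (p x y : 'rV[R[i]]_N) (d t : R) : 0 <= t <= 1 ->
  l1norm (x - p) < d -> l1norm (y - p) < d ->
  l1norm (y + t%:C *: (x - y) - p) < d.
Proof.
move=> /andP[t0 t1] xd yd.
have -> : y + t%:C *: (x - y) - p = t%:C *: (x - p) + (1 - t)%:C *: (y - p).
  by rewrite rmorphB rmorph1 segment_affine.
apply: le_lt_trans (l1normD _ _) _; rewrite !l1normZ !normc_real.
rewrite ger0_norm// ger0_norm ?subr_ge0//.
have xd' : 0 <= t * (d - l1norm (x - p)) by rewrite mulr_ge0 ?subr_ge0// ltW.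
have yd' : 0 <= (1 - t) * (d - l1norm (y - p)) by rewrite mulr_ge0 ?subr_ge0// ltW.
(* One of the weights [t] and [1 - t] is at least 1/2, which makes the convex combination strictly
   smaller than [d]. *)
have [t2|t2] := leP t (1 / 2).
  have : 0 <= (1 - t - 1 / 2) * (d - l1norm (y - p)).
    by apply: mulr_ge0; lra.
  by lra.
have : 0 <= (t - 1 / 2) * (d - l1norm (x - p)).
  by apply: mulr_ge0; lra.
by lra.
Qed.

(** Subtract the linear map ['J f p] from [f]: by continuity of the Jacobian the difference has a
    small derivative near [p], and the mean value inequality on the segment from [y] to [x]
    concludes. *)
Lemma holomorphic_strict_diff N m (U : set 'rV[R[i]]_N) (f : 'rV[R[i]]_N -> 'rV[R[i]]_m) p :
  open U -> U p -> holomorphic_on U f -> forall e : R, 0 < e ->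
  exists2 d : R, 0 < d & forall x y, l1norm (x - p) < d -> l1norm (y - p) < d ->
    l1norm (f x - f y - (x - y) *m 'J f p) <= e * l1norm (x - y).
Proof.
move=> oU Up fU e e0.
have /nbhs_l1normP[d1 d10 d1P] : nbhs p U by exact: open_nbhs_nbhs.
have [_ /continuous_l1normP Jc] := fU p Up.
have e2 : 0 < e / 2 by rewrite divr_gt0.
have [d2 d20 d2P] := Jc _ e2.
exists (Num.min d1 d2) => [|x y]; first by rewrite lt_min d10.
set h := x - y; set d := Num.min d1 d2 => xd yd.
pose phi t : 'rV[R[i]]_m := f (y + t%:C *: h) - f y - t%:C *: (h *m 'J f p).
have -> : f x - f y - h *m 'J f p = phi 1 - phi 0.
  rewrite /phi rmorph1 rmorph0 !scale1r !scale0r.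
  by have -> : y + h = x; rewrite ?addr0 ?subrr ?subr0// /h addrC subrK.
apply: local_to_global_lipschitz => [|t t01]; first by rewrite mulr_ge0 ?l1norm_ge0// ltW.
set z := y + t%:C *: h.
have zd : l1norm (z - p) < d by exact: l1norm_segment.
have [zd1 zd2] : l1norm (z - p) < d1 /\ l1norm (z - p) < d2.
  by apply/andP; rewrite -lt_min.
have [d3 d30 d3P] := differentiable_has_diff (fU z (d1P _ zd1)).1 e2.
(* This keeps [(s - t) h] within the radius of differentiability at [z]; adding 1 covers [h = 0]. *)
exists (d3 / (l1norm h + 1)) => [|s sd].
  by rewrite divr_gt0// ltr_wpDl ?l1norm_ge0.
have shd : l1norm ((s - t)%:C *: h) < d3.
  rewrite ltr_pdivlMr ?ltr_wpDl ?l1norm_ge0// in sd.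
  apply: le_lt_trans sd; rewrite l1normZ normc_real ler_wpM2l// lerDl ler01 //.
have := d3P _ shd.
rewrite l1normZ normc_real => hz.
(* The increment is the differentiability error at [z] plus the change of the Jacobian from [p] to
   [z]; each accounts for [e / 2]. *)
have -> : phi s - phi t = (f (z + (s - t)%:C *: h) - f z - ((s - t)%:C *: h) *m 'J f z)
   + ((s - t)%:C *: h) *m ('J f z - 'J f p).
  have -> : z + (s - t)%:C *: h = y + s%:C *: h.
    by rewrite /z -addrA -scalerDl -rmorphD /= addrCA subrr addr0.
  have E1 M : ((s - t)%:C *: h) *m M = (s%:C - t%:C) *: (h *m M).
    by rewrite -scalemxAl raddfB.
  rewrite !E1 mulmxBr /phi; exact: increment_split.
apply: le_trans (l1normD _ _) _.
apply: (@le_trans _ _ (e / 2 * (`|s - t| * l1norm h) + `|s - t| * l1norm h * (e / 2))).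
  apply: lerD => //; apply: le_trans (l1normM _ _) _; rewrite l1normZ normc_real.
  by rewrite ler_wpM2l ?mulr_ge0 ?l1norm_ge0// ltW// d2P.
by lra.
Qed.

End StrictDifferentiability.

(** * Newton's method, and kernels of differentials as limits of secants *)

Section Secants.
Variable R : realType.

Lemma geometric_bound_le (a b B : R) :
  0 <= B -> (forall j : nat, a <= b + B / 2 ^+ j) -> a <= b.
Proof.
move=> B0 abB; rewrite leNgt; apply/negP => ba.
have [j Bj] : exists j : nat, B < (a - b) * j%:R.
  exists (Num.truncn (B / (a - b))).+1.
  by rewrite mulrC -ltr_pdivrMr ?subr_gt0// truncnS_gt.
have := abB j; apply/negP; rewrite -ltNge -ltrBrDl ltr_pdivrMr ?exprn_gt0//.
apply: lt_le_trans Bj _; rewrite ler_wpM2l ?subr_ge0 ?(ltW ba)//.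
by rewrite -natrX ler_nat ltnW// ltn_expl.
Qed.

(** The intervals centred at [a j] with half-length [2 * (A / 2 ^+ j)] are nested; the supremum of
    their left ends lies in all of them. *)
Lemma geometric_increments_limit (a : nat -> R) (A : R) :
  (forall j, `|a j.+1 - a j| <= A / 2 ^+ j) ->
  exists c, forall j, `|c - a j| <= 2 * A / 2 ^+ j.
Proof.
move=> aA.
have half j : A / 2 ^+ j.+1 = A / 2 ^+ j / 2.
  by rewrite exprS invfM mulrA mulrAC.
have lo i j : (i <= j)%N -> a i - 2 * (A / 2 ^+ i) <= a j - 2 * (A / 2 ^+ j).
  move=> /subnK <-; elim: (j - i)%N => // l IHl; apply: le_trans IHl _.
  by rewrite addSn half; have := aA (l + i)%N; rewrite ler_norml => /andP[h1 h2]; lra.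
have hi i j : (i <= j)%N -> a j + 2 * (A / 2 ^+ j) <= a i + 2 * (A / 2 ^+ i).
  move=> /subnK <-; elim: (j - i)%N => // l IHl; apply: le_trans IHl.
  by rewrite addSn half; have := aA (l + i)%N; rewrite ler_norml => /andP[h1 h2]; lra.
have A0 j : 0 <= A / 2 ^+ j by exact: le_trans (aA j).
have lohi i j : a i - 2 * (A / 2 ^+ i) <= a j + 2 * (A / 2 ^+ j).
  have [/lo ij|/ltnW/hi ji] := leqP i j; first by have := A0 j; lra.
  by have := A0 i; lra.
pose E := range (fun j => a j - 2 * (A / 2 ^+ j)).
have E0 : E !=set0 by exists (a 0 - 2 * (A / 2 ^+ 0)); exists 0.
exists (sup E) => j; rewrite -mulrA ler_distl; apply/andP; split.
  apply: ub_le_sup; last by exists j.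
  by exists (a 0 + 2 * (A / 2 ^+ 0)) => _ [i _ <-].
by apply: ge_sup => // _ [i _ <-].
Qed.

Lemma normc_le_Re_Im (z : R[i]) : normc z <= `|Re z| + `|Im z|.
Proof.
case: z => a b /=; rewrite -ler_sqr ?nnegrE ?sqrtr_ge0 ?addr_ge0//.
rewrite sqr_sqrtr ?addr_ge0 ?sqr_ge0// sqrrD !real_normK ?num_real//.
by rewrite -addrA lerD2l addrC lerDl mulrn_wge0// mulr_ge0.
Qed.

Lemma Re_le_normc (z : R[i]) : `|Re z| <= normc z.
Proof. by have := normc_ge_Re z; rewrite normrC lecR. Qed.

Lemma Im_le_normc (z : R[i]) : `|Im z| <= normc z.
Proof.
by case: z => a b /=; rewrite -sqrtr_sqr ler_wsqrtr// lerDr sqr_ge0.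
Qed.

Lemma geometric_increments_limit_row N (u : nat -> 'rV[R[i]]_N) (A : R) :
  (forall j, l1norm (u j.+1 - u j) <= A / 2 ^+ j) ->
  exists x, forall j, l1norm (x - u j) <= N%:R * (4 * A) / 2 ^+ j.
Proof.
move=> uA.
have uj j k : normc (u j.+1 0 k - u j 0 k) <= A / 2 ^+ j.
  by have := normc_le_l1norm (u j.+1 - u j) 0 k; rewrite !mxE => /le_trans; apply.
have reP k : exists c, forall j, `|c - Re (u j 0 k)| <= 2 * A / 2 ^+ j.
  apply: geometric_increments_limit => j; rewrite -raddfB.
  exact: le_trans (Re_le_normc _) (uj _ _).
have imP k : exists c, forall j, `|c - Im (u j 0 k)| <= 2 * A / 2 ^+ j.
  apply: geometric_increments_limit => j; rewrite -raddfB.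
  exact: le_trans (Im_le_normc _) (uj _ _).
have [a aP] := choice reP; have [b bP] := choice imP.
(* Real and imaginary parts each contribute [2 * A / 2 ^+ j], whence the factor 4, and there are [N]
   coordinates. *)
exists (\row_k (a k +i* b k)) => j.
rewrite /l1norm big_ord1 -!mulrA mulr_natl -[X in _ *+ X]card_ord -sumr_const.
apply: ler_sum => k _; rewrite !mxE.
apply: le_trans (normc_le_Re_Im _) _.
have := aP k j; have := bP k j; case: (u j 0 k) => x y /= h1 h2.
by lra.
Qed.

(** Newton iteration with the fixed right inverse [M] of the differential. A step cancels the linear
    part of [f], so only the linearization error remains, and this is at most half of the previous
    value. *)
Lemma newton_zero N m (f : 'rV[R[i]]_N -> 'rV[R[i]]_m) (p x0 : 'rV[R[i]]_N)
    (J : 'M[R[i]]_(N, m)) (M : 'M[R[i]]_(m, N)) (r eta : R) :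
  M *m J = 1%:M -> 0 <= eta -> eta * l1norm M <= 1 / 2 ->
  (forall x y, l1norm (x - p) < r -> l1norm (y - p) < r ->
    l1norm (f x - f y - (x - y) *m J) <= eta * l1norm (x - y)) ->
  l1norm (x0 - p) + 2 * (l1norm M * l1norm (f x0)) < r ->
  exists x, f x = 0 /\ l1norm (x - x0) <= 2 * (l1norm M * l1norm (f x0)).
Proof.
move=> MJ eta0 etaM fP; set F := l1norm (f x0); set A := l1norm M * F => x0r.
have F0 : 0 <= F by exact: l1norm_ge0.
have A0 : 0 <= A by rewrite mulr_ge0 ?l1norm_ge0.
have in_ball y : l1norm (y - x0) <= 2 * A -> l1norm (y - p) < r.
  by move=> yx0; apply: le_lt_trans (l1normB _ x0 _) _; lra.
pose u j := iter j (fun x => x - f x *m M) x0.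
have uS j : u j.+1 - u j = - (f (u j) *m M) by rewrite /u iterS addrAC subrr add0r.
have half (c : R) j : c / 2 ^+ j.+1 = c / 2 ^+ j / 2.
  by rewrite exprS invfM mulrA mulrAC.
have pow0 j : 0 < (2 ^+ j : R)^-1 by rewrite invr_gt0 exprn_gt0.
(* [2 * A - 2 * (A / 2 ^+ j)] is the sum of the first [j] terms of the geometric series that starts
   with [A] and has ratio 1/2. *)
have invariant j : l1norm (u j - x0) <= 2 * A - 2 * (A / 2 ^+ j) /\
    l1norm (f (u j)) <= F / 2 ^+ j.
  elim: j => [|j [IH1 IH2]].
    by rewrite /u /= subrr l1norm0 expr0 !divr1 subrr.
  have inc : l1norm (u j.+1 - u j) <= l1norm M * l1norm (f (u j)).
    by rewrite uS l1normN mulrC l1normM.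
  have incA : l1norm (u j.+1 - u j) <= A / 2 ^+ j.
    by apply: le_trans inc _; rewrite -mulrA ler_wpM2l ?l1norm_ge0.
  have uSj : l1norm (u j.+1 - x0) <= 2 * A - 2 * (A / 2 ^+ j.+1).
    by apply: le_trans (l1normB _ (u j) _) _; rewrite half; lra.
  have Aj : 0 <= A / 2 ^+ j by rewrite divr_ge0 ?exprn_ge0.
  have AjS : 0 <= A / 2 ^+ j.+1 by rewrite divr_ge0 ?exprn_ge0.
  split=> //.
  (* As [M *m J = 1], the step times [J] equals [- f (u j)], so the new value is exactly a
     linearization error. *)
  have -> : f (u j.+1) = f (u j.+1) - f (u j) - (u j.+1 - u j) *m J.
    by rewrite uS mulNmx opprK -mulmxA MJ mulmx1 subrK.
  apply: le_trans (fP _ _ _ _) _; [apply: in_ball; lra|apply: in_ball; lra|].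
  rewrite half.
  have : eta * l1norm (u j.+1 - u j) <= eta * (l1norm M * l1norm (f (u j))).
    by rewrite ler_wpM2l.
  have : eta * l1norm M * l1norm (f (u j)) <= 1 / 2 * l1norm (f (u j)).
    by rewrite ler_wpM2r ?l1norm_ge0.
  rewrite -mulrA; lra.
have inc j : l1norm (u j.+1 - u j) <= A / 2 ^+ j.
  rewrite uS l1normN; apply: le_trans (l1normM _ _) _.
  by rewrite mulrC -mulrA ler_wpM2l ?l1norm_ge0//; have [] := invariant j.
have [x xP] := geometric_increments_limit_row inc.
set B := N%:R * (4 * A) in xP.
have B0 : 0 <= B by rewrite mulr_ge0// mulr_ge0.
have x_close : l1norm (x - x0) <= 2 * A.
  apply: geometric_bound_le B0 _ => j; apply: le_trans (l1normB _ (u j) _) _.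
  have [h _] := invariant j; have := xP j.
  have : 0 <= A / 2 ^+ j by rewrite divr_ge0 ?exprn_ge0.
  by lra.
exists x; split=> //; apply: l1norm_eq0; apply/eqP; rewrite eq_le l1norm_ge0 andbT.
have J0 := l1norm_ge0 J.
(* The three terms bound the linearization error between [x] and [u j], the linear part, and
   [f (u j)]. *)
apply: (@geometric_bound_le _ _ (eta * B + B * l1norm J + F)) => [|j].
  by apply: addr_ge0 => //; apply: addr_ge0; apply: mulr_ge0.
have [h1 h2] := invariant j.
have ujr : l1norm (u j - p) < r.
  apply: in_ball; have : 0 <= A / 2 ^+ j by rewrite divr_ge0 ?exprn_ge0.
  lra.
have := fP _ _ (in_ball _ x_close) ujr.
set D := _ - _ *m J => hD.
have -> : f x = D + (x - u j) *m J + f (u j) by rewrite /D !subrK.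
apply: le_trans (l1normD _ _) _; rewrite add0r.
have := l1normD D ((x - u j) *m J); have := l1normM (x - u j) J.
have : l1norm (x - u j) * l1norm J <= B / 2 ^+ j * l1norm J by rewrite ler_wpM2r.
have : eta * l1norm (x - u j) <= eta * (B / 2 ^+ j) by rewrite ler_wpM2l.
rewrite !mulrDl -(mulrA eta) -(mulrAC B) => *; lra.
Qed.

(** Tangency to first order, phrased through the set [S] alone, so that kernels coming from
    different equations can be compared. *)
Definition secant_direction N (S : set 'rV[R[i]]_N) p (v : 'rV[R[i]]_N) :=
  forall e : R, 0 < e -> exists2 d : R, 0 < d & forall t : R, 0 < t < d ->
    exists2 x, S x & l1norm (x - (p + t%:C *: v)) <= e * t.

(** Since [v] is killed by the differential, [f] is $o(t)$ at [p + t v]; Newton's method then finds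
    a true zero at distance $o(t)$. *)
Lemma kernel_secant N m (S : set 'rV[R[i]]_N) p (f : 'rV[R[i]]_N -> 'rV[R[i]]_m) v :
  submersive_equations S p f -> v *m 'J f p = 0 -> secant_direction S p v.
Proof.
move=> [Sp [U [oU Up fU SU rkf]]] vJ e e0.
have /row_fullP[M MJ] : row_full ('J f p) by rewrite /row_full rkf.
have M0 := l1norm_ge0 M; have v0 := l1norm_ge0 v.
have fp : f p = 0 by exact/SU.
have [r1 r10 r1U] : exists2 r : R, 0 < r & forall x, l1norm (x - p) < r -> U x.
  by apply/nbhs_l1normP; exact: open_nbhs_nbhs.
pose K := 2 * (l1norm M + 1) * (l1norm v + 1).
have K0 : 0 < K by rewrite !mulr_gt0// ltr_wpDl.
(* The first bound makes Newton's method contract; the second makes its total displacement, at most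
   [2 |M| eta t |v|], no larger than [e * t]. *)
pose eta := Num.min (1 / (2 * (l1norm M + 1))) (e / K).
have eta0 : 0 < eta by rewrite lt_min !divr_gt0// mulr_gt0// ltr_wpDl.
have eta1 : eta * l1norm M <= 1 / 2.
  have : eta <= 1 / (2 * (l1norm M + 1)) by rewrite ge_min lexx.
  rewrite ler_pdivlMr ?mulr_gt0 ?ltr_wpDl// => h.
  lra.
have eta2 : eta * K <= e.
  by rewrite -ler_pdivlMr// ge_min lexx orbT.
have [r2 r20 r2P] := holomorphic_strict_diff oU Up fU eta0.
pose r := Num.min r1 r2.
have r0 : 0 < r by rewrite lt_min r10.
exists (r / (l1norm v + e + 1)) => [|t /andP[t0]].
  by rewrite divr_gt0// ltr_wpDl// addr_ge0// ltW.
rewrite ltr_pdivlMr; last by rewrite ltr_wpDl// addr_ge0// ltW.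
move=> tr.
have tv : l1norm (p + t%:C *: v - p) = t * l1norm v.
  by rewrite addrAC subrr add0r l1normZ normc_real gtr0_norm.
have te : 0 < t * e by rewrite mulr_gt0.
have tv0 : 0 <= t * l1norm v by rewrite mulr_ge0// ltW.
have tvr : t * l1norm v < r by lra.
have r2r : r <= r2 by rewrite ge_min lexx orbT.
have r1r : r <= r1 by rewrite ge_min lexx.
have fx0 : l1norm (f (p + t%:C *: v)) <= eta * (t * l1norm v).
  have := r2P (p + t%:C *: v) p; rewrite tv subrr l1norm0 fp subr0.
  have -> : (p + t%:C *: v - p) *m 'J f p = 0.
    by rewrite addrAC subrr add0r -scalemxAl vJ scaler0.
  by rewrite subr0; apply; lra.
have close : 2 * (l1norm M * l1norm (f (p + t%:C *: v))) <= e * t.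
  have h1 : l1norm M * l1norm (f (p + t%:C *: v)) <= l1norm M * (eta * (t * l1norm v)).
    by rewrite ler_wpM2l.
  have h2 : eta * K * t <= e * t by rewrite ler_wpM2r// ltW.
  have : 0 <= eta * t by rewrite mulr_ge0// ltW.
  have : 0 <= eta * t * l1norm M by rewrite !mulr_ge0// ltW.
  have : 0 <= eta * t * l1norm v by rewrite !mulr_ge0// ltW.
  rewrite /K in h2; lra.
have [||x [fx xv]] := @newton_zero _ _ f p (p + t%:C *: v) _ M r eta MJ (ltW eta0) eta1 _ _.
- by move=> x y xr yr; apply: r2P; lra.
- by rewrite tv; lra.
exists x; last exact: le_trans xv close.
apply/SU => //; apply: r1U; apply: le_lt_trans (l1normB _ (p + t%:C *: v) _) _.
by rewrite tv; lra.
Qed.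

(** [f] vanishes at points $p + tv + o(t)$ of [S]; expand [f] to first order at [p] and divide by
    [t]. *)
Lemma secant_kernel N m (S : set 'rV[R[i]]_N) p (f : 'rV[R[i]]_N -> 'rV[R[i]]_m) v :
  submersive_equations S p f -> secant_direction S p v -> v *m 'J f p = 0.
Proof.
move=> [Sp [U [oU Up fU SU _]]] vS.
have fp : f p = 0 by exact/SU.
have [r1 r10 r1U] : exists2 r : R, 0 < r & forall x, l1norm (x - p) < r -> U x.
  by apply/nbhs_l1normP; exact: open_nbhs_nbhs.
apply: l1norm_eq0; apply/eqP; rewrite eq_le l1norm_ge0 andbT.
have J0 := l1norm_ge0 ('J f p); have v0 := l1norm_ge0 v.
apply/ler_addgt0Pr => e e0; rewrite add0r.
(* [l1norm v + 1] pays for the first-order error at [x], and [l1norm ('J f p)] for the deviation of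
   [x] from [p + t v]. *)
pose K := l1norm v + 1 + l1norm ('J f p).
have K0 : 0 < K by rewrite /K; lra.
pose eta := Num.min 1 (e / K).
have eta0 : 0 < eta by rewrite lt_min ltr01 divr_gt0.
have eta1 : eta <= 1 by rewrite ge_min lexx.
have etaK : eta * K <= e by rewrite -ler_pdivlMr// ge_min lexx orbT.
have [d2 d20 d2P] := differentiable_has_diff (fU p Up).1 eta0.
have [d d0 dP] := vS eta eta0.
have v2 : 0 < l1norm v + 2 by lra.
pose t := Num.min (d / 2) (Num.min r1 d2 / (l1norm v + 2)).
have t0 : 0 < t by rewrite !lt_min !divr_gt0// lt_min r10.
have td : t < d by rewrite gt_min; apply/orP; left; lra.
have : t <= Num.min r1 d2 / (l1norm v + 2) by rewrite ge_min lexx orbT.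
rewrite ler_pdivlMr// le_min => /andP[tr1 td2].
have [|x Sx xt] := dP t; first by rewrite t0.
pose w := x - (p + t%:C *: v).
have wt : l1norm w <= eta * t by [].
have wt' : eta * t <= t by rewrite ler_piMl// ltW.
have xp : x - p = w + t%:C *: v by rewrite /w opprD addrA subrK.
have nxp : l1norm (x - p) <= t * (l1norm v + 1).
  rewrite xp; apply: le_trans (l1normD _ _) _.
  by rewrite l1normZ normc_real gtr0_norm//; lra.
have tlt : t * (l1norm v + 1) < t * (l1norm v + 2) by rewrite ltr_pM2l//; lra.
have fx : f x = 0 by apply/SU => //; apply: r1U; lra.
have hJ : l1norm ((x - p) *m 'J f p) <= eta * l1norm (x - p).
  have := d2P (x - p); rewrite [p + _]addrC subrK fx fp subrr add0r l1normN.
  by apply; lra.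
have : t * l1norm (v *m 'J f p) <= t * e.
  have -> : t * l1norm (v *m 'J f p) = l1norm ((x - p) *m 'J f p - w *m 'J f p).
    by rewrite xp -mulmxBl addrAC subrr add0r -scalemxAl l1normZ normc_real gtr0_norm.
  apply: le_trans (l1normD _ _) _; rewrite l1normN.
  have h1 := l1normM w ('J f p).
  have h2 : l1norm w * l1norm ('J f p) <= eta * t * l1norm ('J f p) by rewrite ler_wpM2r.
  have h3 : eta * l1norm (x - p) <= eta * (t * (l1norm v + 1)).
    by rewrite ler_wpM2l// ltW.
  have h4 : t * (eta * K) <= t * e by rewrite ler_wpM2l// ltW.
  rewrite /K in h4; lra.
by rewrite ler_pM2l.
Qed.

End Secants.

(** When [J'] is close to [J] this makes [a] smaller than itself, hence zero: full rank is an open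
    condition. *)
Lemma perturbed_left_inverse (K : comPzRingType) N m (J J' : 'M[K]_(N, m)) M
    (a : 'rV_m) : M *m J = 1%:M -> a *m J'^T = 0 -> a = - (a *m (J' - J)^T *m M^T).
Proof.
move=> MJ aJ'; rewrite linearB /= mulmxBr aJ' sub0r mulNmx opprK -mulmxA.
by rewrite -trmx_mul MJ trmx1 mulmx1.
Qed.

(** * Submersive equations, their stability, and tangent spaces *)

Section SubmersiveEquations.
Variable R : realType.

Lemma rank_full_colP N m (J : 'M[R[i]]_(N, m)) :
  \rank J = m <-> forall a : 'rV_m, a *m J^T = 0 -> a = 0.
Proof.
split=> [rkJ a aJ|aP].
  have fJ : row_free J^T by rewrite /row_free mxrank_tr rkJ.
  by apply: (row_free_inj fJ); rewrite mul0mx.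
apply/eqP; rewrite -mxrank_tr -/(row_free J^T) -kermx_eq0; apply/eqP/row_matrixP => j.
by rewrite row0; apply: aP; apply/sub_kermxP; exact: row_sub.
Qed.

Lemma has_diff_mulmxr N m (J : 'M[R[i]]_(N, m)) p : has_diff (mulmxr J) p J.
Proof.
move=> e e0; exists 1 => // h _.
by rewrite /= mulmxDl -addrA -opprD subrr l1norm0 mulr_ge0 ?l1norm_ge0// ltW.
Qed.

Lemma has_diff_row_mx N m1 m2 (f1 : 'rV[R[i]]_N -> 'rV[R[i]]_m1)
    (f2 : 'rV[R[i]]_N -> 'rV[R[i]]_m2) p J1 J2 :
  has_diff f1 p J1 -> has_diff f2 p J2 ->
  has_diff (fun x => row_mx (f1 x) (f2 x)) p (row_mx J1 J2).
Proof.
move=> h1 h2 e e0.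
have e2 : 0 < e / 2 by rewrite divr_gt0.
have [d1 d10 d1P] := h1 _ e2; have [d2 d20 d2P] := h2 _ e2.
exists (Num.min d1 d2) => [|h]; first by rewrite lt_min d10.
rewrite lt_min => /andP[/d1P hd1 /d2P hd2].
rewrite mul_mx_row !opp_row_mx !add_row_mx l1norm_row_mx.
have := lerD hd1 hd2; lra.
Qed.

Lemma has_diff_lsubmx N1 N2 m (f : 'rV[R[i]]_N1 -> 'rV[R[i]]_m)
    (p : 'rV[R[i]]_(N1 + N2)) J :
  has_diff f (lsubmx p) J -> has_diff (fun x => f (lsubmx x)) p (col_mx J 0).
Proof.
move=> hf e e0; have [d d0 dP] := hf _ e0; exists d => // h hd.
have hl : l1norm (lsubmx h) <= l1norm h by rewrite (l1norm_split h) lerDl l1norm_ge0.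
rewrite -[h in h *m _]hsubmxK mul_row_col mulmx0 addr0 linearD /=.
apply: le_trans (dP _ (le_lt_trans hl hd)) _.
by rewrite ler_wpM2l// ltW.
Qed.

Lemma holomorphic_onI N m (U : set 'rV[R[i]]_N) (f : 'rV[R[i]]_N -> 'rV[R[i]]_m)
    (J : 'rV[R[i]]_N -> 'M[R[i]]_(N, m)) :
  open U -> (forall p, U p -> has_diff f p (J p)) ->
  (forall p, U p -> {for p, continuous J}) -> holomorphic_on U f.
Proof.
move=> oU fJ Jc p Up; split; first by have [] := has_diff_diff (fJ p Up).
have [r r0 rU] : exists2 r : R, 0 < r & forall x, l1norm (x - p) < r -> U x.
  by apply/nbhs_l1normP; exact: open_nbhs_nbhs.
apply/continuous_l1normP => e e0.
have /continuous_l1normP/(_ _ e0)[d d0 dP] := Jc p Up.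
exists (Num.min r d) => [|x]; first by rewrite lt_min r0.
rewrite lt_min => /andP[/rU Ux /dP].
by rewrite (has_diff_jacobian (fJ x Ux)) (has_diff_jacobian (fJ p Up)).
Qed.

Lemma continuous_lipschitz m n m' n' (f : 'M[R[i]]_(m, n) -> 'M[R[i]]_(m', n')) p K :
  (forall x, l1norm (f x - f p) <= K * l1norm (x - p)) -> {for p, continuous f}.
Proof.
move=> fK; apply/continuous_l1normP => e e0.
exists (e / (`|K| + 1)) => [|x]; first by rewrite divr_gt0// ltr_wpDl.
rewrite ltr_pdivlMr ?ltr_wpDl// => xe; apply: le_lt_trans (fK x) _.
apply: le_lt_trans xe; rewrite mulrC ler_wpM2l ?l1norm_ge0//.
by apply: le_trans (ler_norm K) _; rewrite lerDl.
Qed.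

Lemma continuous_row_mx N m n1 n2 (F : 'rV[R[i]]_N -> 'M[R[i]]_(m, n1))
    (G : 'rV[R[i]]_N -> 'M[R[i]]_(m, n2)) p :
  {for p, continuous F} -> {for p, continuous G} ->
  {for p, continuous (fun x => row_mx (F x) (G x))}.
Proof.
move=> /continuous_l1normP Fc /continuous_l1normP Gc.
apply/continuous_l1normP => e e0.
have e2 : 0 < e / 2 by rewrite divr_gt0.
have [d1 d10 d1P] := Fc _ e2; have [d2 d20 d2P] := Gc _ e2.
exists (Num.min d1 d2) => [|h]; first by rewrite lt_min d10.
rewrite lt_min => /andP[/d1P hd1 /d2P hd2].
rewrite opp_row_mx add_row_mx l1norm_row_mx.
have := ltrD hd1 hd2; lra.
Qed.

Lemma l1ball_open N (p : 'rV[R[i]]_N) r : open [set x | l1norm (x - p) < r].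
Proof.
rewrite openE => x /= xr; apply/nbhs_l1normP; exists (r - l1norm (x - p)).
  by rewrite subr_gt0.
move=> y yx /=; apply: le_lt_trans (l1normB _ x _) _; lra.
Qed.

Lemma submersive_equations_near N m (S : set 'rV[R[i]]_N) p (f : 'rV[R[i]]_N -> 'rV[R[i]]_m) :
  submersive_equations S p f -> exists2 r : R, 0 < r & forall x, l1norm (x - p) < r ->
    (S x <-> f x = 0) /\ (S x -> submersive_equations S x f).
Proof.
move=> [Sp [U [oU Up fU SU rkf]]].
have /row_fullP[M MJ] : row_full ('J f p) by rewrite /row_full rkf.
have [r r0 rU] : exists2 r : R, 0 < r & forall x, l1norm (x - p) < r -> U x.
  by apply/nbhs_l1normP; exact: open_nbhs_nbhs.
have M1 : 0 < l1norm M + 1 by rewrite ltr_wpDl ?l1norm_ge0.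
(* With this radius the perturbation of the Jacobian times [l1norm M] stays below 1. *)
have e0 : 0 < (l1norm M + 1)^-1 by rewrite invr_gt0.
have [_ /continuous_l1normP/(_ _ e0)[d d0 dP]] := fU p Up.
exists (Num.min r d) => [|x]; first by rewrite lt_min r0.
rewrite lt_min => /andP[/rU Ux /dP Jx]; split; first exact: SU.
move=> Sx; split; first exact: Sx.
exists U; split; [exact: oU|exact: Ux|exact: fU|exact: SU|].
apply/rank_full_colP => a aJ.
have aE : a = - (a *m ('J f x - 'J f p)^T *m M^T).
  exact: perturbed_left_inverse.
apply: l1norm_eq0; apply/eqP; rewrite eq_le l1norm_ge0 andbT.
have h1 : l1norm a <= l1norm a * (l1norm ('J f x - 'J f p) * l1norm M).
  rewrite {1}aE l1normN -mulmxA; apply: le_trans (l1normM _ _) _.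
  apply: ler_wpM2l; first exact: l1norm_ge0.
  by apply: le_trans (l1normM _ _) _; rewrite !l1norm_tr.
rewrite leNgt; apply/negP => a0.
have : l1norm ('J f x - 'J f p) * l1norm M < 1.
  rewrite -(mulVf (lt0r_neq0 M1)).
  apply: (@le_lt_trans _ _ ((l1norm M + 1)^-1 * l1norm M)).
    by rewrite ler_wpM2r ?l1norm_ge0// ltW.
  by rewrite ltr_pM2l// ltrDl.
rewrite -(ltr_pM2l a0) mulr1 => h2.
by have := le_lt_trans h1 h2; rewrite ltxx.
Qed.

Lemma submersive_equations_congr N m (S T : set 'rV[R[i]]_N) p r
    (f : 'rV[R[i]]_N -> 'rV[R[i]]_m) : 0 < r ->
  (forall x, l1norm (x - p) < r -> (S x <-> T x)) ->
  submersive_equations T p f -> submersive_equations S p f.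
Proof.
move=> r0 ST [Tp [U [oU Up fU TU rkf]]].
have pr : l1norm (p - p) < r by rewrite subrr l1norm0.
split; first exact/ST.
exists (U `&` [set x | l1norm (x - p) < r]); split=> //.
- by apply: openI => //; exact: l1ball_open.
- by move=> x [Ux _]; exact: fU.
- by move=> x [Ux xr]; rewrite ST// TU.
Qed.

Lemma submersive_smooth N m (S : set 'rV[R[i]]_N) p (f : 'rV[R[i]]_N -> 'rV[R[i]]_m) :
  submersive_equations S p f -> smooth_points S p.
Proof.
move=> Sf; have [_ [U [_ _ _ _ rkf]]] := Sf.
exists (N - m)%N, m, f; split=> //; rewrite subnKC//.
by rewrite -rkf rank_leq_row.
Qed.

Lemma submersive_mulmxr N m (J : 'M[R[i]]_(N, m)) p : \rank J = m -> p *m J = 0 ->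
  submersive_equations [set x | x *m J = 0] p (mulmxr J).
Proof.
move=> rkJ pJ; split=> //; exists setT; split=> //.
- exact: openT.
- apply: (@holomorphic_onI _ _ _ _ (fun=> J)) => // [|q _|q _].
  + exact: openT.
  + exact: has_diff_mulmxr.
  + by apply: (@continuous_lipschitz _ _ _ _ _ _ 0) => x; rewrite subrr l1norm0 mul0r.
- by rewrite (has_diff_jacobian (has_diff_mulmxr J p)).
Qed.

(** The equations [g] behind [A] and the given [f] have the same kernel, since both kernels consist
    of the secant directions of [S]. *)
Lemma tangent_spaceP N m (S : set 'rV[R[i]]_N) p (f : 'rV[R[i]]_N -> 'rV[R[i]]_m) A :
  submersive_equations S p f -> tangent_space S p A ->
  forall v, v \in A <-> v *m 'J f p = 0.
Proof.
move=> Sf [m' [g [Sg AE]]] v; rewrite AE.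
have [Sp [U [_ Up gU _ _]]] := Sg.
rewrite (diff_jacobianE _ (gU p Up).1).
by split=> [/(kernel_secant Sg)/(secant_kernel Sf)|/(kernel_secant Sf)/(secant_kernel Sg)].
Qed.

Lemma tangent_space_ex N m (S : set 'rV[R[i]]_N) p (f : 'rV[R[i]]_N -> 'rV[R[i]]_m) :
  submersive_equations S p f -> exists A, tangent_space S p A.
Proof.
move=> Sf; have [Sp [U [_ Up fU _ _]]] := Sf.
exists (lker (linfun (mulmxr ('J f p) : 'rV[R[i]]_N -> 'rV[R[i]]_m))), m, f.
split=> // v; rewrite memv_ker lfunE /= (diff_jacobianE _ (fU p Up).1).
by split=> [/eqP|->].
Qed.

End SubmersiveEquations.

(** * The Hermitian norm and the distance between subspaces *)

Section HermitianDistance.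
Variables (R : realType) (N : nat).
Implicit Types u v : 'rV[R[i]]_N.

Lemma hnorm_ge0 v : 0 <= hnorm v.
Proof. exact: sqrtr_ge0. Qed.

Lemma normc_le_hnorm v j : normc (v 0 j) <= hnorm v.
Proof.
rewrite -[leLHS]ger0_norm ?normc_ge0// -sqrtr_sqr ler_wsqrtr//.
by rewrite (bigD1 j)//= lerDl sumr_ge0// => l _; rewrite sqr_ge0.
Qed.

Lemma l1norm_le_hnorm v : l1norm v <= N%:R * hnorm v.
Proof.
rewrite /l1norm big_ord1 mulr_natl -[X in _ *+ X]card_ord -sumr_const.
by apply: ler_sum => j _; exact: normc_le_hnorm.
Qed.

Lemma hnorm_le_l1norm v : hnorm v <= l1norm v.
Proof.
rewrite -ler_sqr ?nnegrE ?sqrtr_ge0 ?l1norm_ge0// sqr_sqrtr; last first.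
  by apply: sumr_ge0 => j _; rewrite sqr_ge0.
rewrite [leRHS]expr2 {1}/l1norm big_ord1 mulr_suml; apply: ler_sum => j _.
by rewrite expr2 ler_wpM2l ?normc_ge0// normc_le_l1norm.
Qed.

Lemma hdotE u v : hdot u v = (u *m (map_mx (@conjc R) v)^T) 0 0.
Proof. by rewrite mxE; apply: eq_bigr => j _; rewrite !mxE. Qed.

Lemma l1norm_conj v : l1norm (map_mx (@conjc R) v) = l1norm v.
Proof. by apply: eq_bigr => i _; apply: eq_bigr => j _; rewrite mxE normc_conj. Qed.

Lemma normc_hdot_le u v : normc (hdot u v) <= l1norm u * l1norm v.
Proof.
rewrite hdotE; apply: le_trans (normc_le_l1norm _ 0 0) _.
by apply: le_trans (l1normM _ _) _; rewrite l1norm_tr l1norm_conj.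
Qed.

Lemma hnorm_gt0 v : v != 0 -> 0 < hnorm v.
Proof.
move=> /l1norm_gt0 v0; rewrite lt_def hnorm_ge0 andbT; apply/eqP => h0.
by have := l1norm_le_hnorm v; rewrite h0 mulr0 leNgt v0.
Qed.

Lemma hnorm0 : hnorm (0 : 'rV[R[i]]_N) = 0.
Proof.
by apply/eqP; rewrite eq_le hnorm_ge0 andbT (le_trans (hnorm_le_l1norm _))// l1norm0.
Qed.

Lemma ratio_le_dist (A B : {vspace 'rV[R[i]]_N}) u v :
  u \in A -> u != 0 -> v != 0 -> (forall b, b \in B -> hdot b v = 0) ->
  normc (hdot u v) / (hnorm u * hnorm v) <= dist A B.
Proof.
move=> uA u0 v0 vB; apply: ub_le_sup; last by exists u, v.
(* A crude bound on the ratios, from comparing the two norms; it makes the supremum a genuine upper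
   bound. *)
exists (N%:R * N%:R) => _ [u' [v' [_ u'0 v'0 _ ->]]].
rewrite ler_pdivrMr ?mulr_gt0 ?hnorm_gt0//; apply: le_trans (normc_hdot_le _ _) _.
by rewrite mulrACA ler_pM ?l1norm_ge0 ?l1norm_le_hnorm.
Qed.

Lemma dist_ge0 (A B : {vspace 'rV[R[i]]_N}) : 0 <= dist A B.
Proof.
have [E0|/set0P[r [u [v [uA u0 v0 vB rE]]]]] := eqVneq [set r | exists u v, [/\ u \in A,
    u != 0, v != 0, forall b, b \in B -> hdot b v = 0
    & r = normc (hdot u v) / (hnorm u * hnorm v)]] set0.
  by rewrite /dist E0 sup0.
apply: le_trans (ratio_le_dist uA u0 v0 vB).
by rewrite divr_ge0 ?normc_ge0// mulr_ge0 ?hnorm_ge0.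
Qed.

Lemma le_dist (A B : {vspace 'rV[R[i]]_N}) u v :
  u \in A -> (forall b, b \in B -> hdot b v = 0) ->
  normc (hdot u v) <= dist A B * (hnorm u * hnorm v).
Proof.
move=> uA vB.
have [->|u0] := eqVneq u 0.
  rewrite /hdot big1 ?ComplexField.Normc.normc0 => [|j _]; last by rewrite mxE mul0r.
  by rewrite hnorm0 mul0r mulr0.
have [->|v0] := eqVneq v 0.
  rewrite hdotE map_mx0 trmx0 mulmx0 mxE ComplexField.Normc.normc0.
  by rewrite hnorm0 !mulr0.
rewrite -ler_pdivrMr ?mulr_gt0 ?hnorm_gt0//; exact: ratio_le_dist.
Qed.

Lemma dist_le (A B : {vspace 'rV[R[i]]_N}) (K : R) : 0 <= K ->
  (forall u v, u \in A -> (forall b, b \in B -> hdot b v = 0) ->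
    normc (hdot u v) <= K * (hnorm u * hnorm v)) ->
  dist A B <= K.
Proof.
move=> K0 KP; rewrite /dist; set E := [set _ | _].
have [->|E0] := eqVneq E set0; first by rewrite sup0.
apply: ge_sup; first exact/set0P.
move=> _ [u [v [uA u0 v0 vB ->]]].
by rewrite ler_pdivrMr ?mulr_gt0 ?hnorm_gt0// KP.
Qed.

(** Conjugation turns Hermitian orthogonality into annihilation of the kernel of [J]. The columns of
    the cokernel matrix of [J^T] give vectors of that kernel, so the conjugate of [v] lies in the
    row space of [J^T]. *)
Lemma normal_vector_rowspace m (J : 'M[R[i]]_(N, m)) v :
  (forall b : 'rV_N, b *m J = 0 -> hdot b v = 0) ->
  exists a : 'rV_m, map_mx (@conjc R) v = a *m J^T.
Proof.
move=> vP; apply/submxP; rewrite submxE; apply/eqP.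
set vb := map_mx _ _; set K := cokermx _.
have JK : K^T *m J = 0 by rewrite -[J]trmxK -trmx_mul mulmx_coker trmx0.
have KJ : K^T *m vb^T = 0.
  apply/row_matrixP => i; rewrite row_mul row0; apply/rowP => j.
  by rewrite [RHS]mxE ord1 -hdotE; apply: vP; rewrite -row_mul JK row0.
by apply: trmx_inj; rewrite trmx_mul KJ trmx0.
Qed.

End HermitianDistance.

(** The product rule for the incidence equation, bilinear in the point and the coefficients: the
    remainder is the product of the two increments. *)
Lemma bilinear_increment (K : comPzRingType) k n q (x dx : 'rV[K]_(k + n))
    (c : 'cV[K]_(k + n)) (P : 'M[K]_(n, q)) (dw : 'rV[K]_q) :
  (x + dx) *m (c + col_mx 0 (P *m dw^T)) - x *m c
    - row_mx dx dw *m col_mx c (rsubmx x *m P)^T = rsubmx dx *m P *m dw^T.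
Proof.
have E (y : 'rV[K]_(k + n)) : y *m col_mx 0 (P *m dw^T) = rsubmx y *m P *m dw^T.
  by rewrite -{1}[y]hsubmxK mul_row_col mulmx0 add0r mulmxA.
have T : rsubmx x *m P *m dw^T = dw *m (rsubmx x *m P)^T.
  have S (M : 'M[K]_1) : M^T = M by rewrite [M]mx11_scalar tr_scalar_mx.
  by rewrite -[LHS]S trmx_mul trmxK.
rewrite mulmxDr !mulmxDl !E mul_row_col T.
set a := x *m c; set b := dx *m c; set d := dw *m _; set e := _ *m _ *m _.
by apply/matrixP => i j; rewrite !mxE; ring.
Qed.

(** * Affine charts of the dual projective space *)

Section Charts.
Variables (R : realType) (k n : nat) (i : 'I_n).
Implicit Types (x : 'rV[R[i]]_(k + n)) (w : 'rV[R[i]]_n.-1) (z : 'rV[R[i]]_n).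

(** Right multiplication drops the coordinate $z_i$, giving the $z'$ that multiplies $w$ in $l_w$;
    the transpose embeds the chart coordinates among the coefficients of $l_w$. *)
Definition chart_proj : 'M[R[i]]_(n, n.-1) := \matrix_(j, l) (j == lift i l)%:R.

Lemma mulmx_chart_proj z l : (z *m chart_proj) 0 l = z 0 (lift i l).
Proof.
rewrite mxE (bigD1 (lift i l))//= !mxE eqxx mulr1 big1 ?addr0// => j jl.
by rewrite !mxE (negPf jl) mulr0.
Qed.

Lemma chart_formE w : chart_form i w = delta_mx 0 i + w *m chart_proj^T.
Proof.
apply/rowP => j; rewrite /chart_form !mxE eqxx /=.
case: unliftP => [l ->|->].
  rewrite [lift i l == i]eq_sym (negPf (neq_lift _ _)) add0r.
  rewrite (bigD1 l)//= !mxE eqxx mulr1 big1 ?addr0// => l' ll'.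
  by rewrite !mxE (inj_eq lift_inj) eq_sym (negPf ll') mulr0.
rewrite eqxx big1 ?addr0// => l _.
by rewrite !mxE (negPf (neq_lift _ _)) mulr0.
Qed.

Definition chart_covector w : 'cV[R[i]]_(k + n) := col_mx 0 (chart_form i w)^T.

Lemma chart_covectorD w dw :
  chart_covector (w + dw) = chart_covector w + col_mx 0 (chart_proj *m dw^T).
Proof.
rewrite /chart_covector add_col_mx addr0 !chart_formE mulmxDl addrA linearD /=.
by rewrite trmx_mul trmxK.
Qed.

Lemma mulmx_chart_covector x w :
  x *m chart_covector w = rsubmx x *m (chart_form i w)^T.
Proof. by rewrite -[x in LHS]hsubmxK mul_row_col mulmx0 add0r. Qed.

Lemma mem_chart_hyperplane x w :
  x \in chart_hyperplane k i w <-> x *m chart_covector w = 0.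
Proof. by rewrite memv_ker lfunE /=; split=> [/eqP|->]. Qed.

Lemma chart_hyperplane_dualP w : dualP R k n (chart_hyperplane k i w).
Proof.
split; last first.
  by move=> x /= x0; apply/mem_chart_hyperplane; rewrite mulmx_chart_covector x0 mul0mx.
set f : 'rV[R[i]]_(k + n) -> 'rV[R[i]]_1 := mulmxr (chart_covector w).
have fE x : linfun f x = x *m chart_covector w by rewrite lfunE.
have dimE : (\dim (chart_hyperplane k i w) + \dim (limg (linfun f)))%N = (k + n)%N.
  by have := limg_ker_dim (linfun f) fullv; rewrite capfv dimvf /dim /= mul1n.
suff dim1 : \dim (limg (linfun f)) = 1%N by rewrite dim1 addn1 in dimE.
apply/eqP; rewrite eqn_leq; apply/andP; split.
  by rewrite (leq_trans (dimvS (subvf _)))// dimvf.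
rewrite lt0n dimv_eq0; apply/eqP => f0.
(* The form takes the value 1 on the $z_i$ coordinate vector, so its image is not zero. *)
have : linfun f (row_mx 0 (delta_mx 0 i)) \in limg (linfun f) by rewrite memv_img ?memvf.
rewrite f0 memv0 fE mulmx_chart_covector row_mxKr => /eqP/matrixP/(_ 0 0).
rewrite -rowE mxE mxE /chart_form mxE unlift_none mxE => /eqP.
by rewrite oner_eq0.
Qed.

Lemma l1norm_lift z :
  l1norm z = normc (z 0 i) + l1norm (z *m chart_proj).
Proof.
have -> : l1norm (z *m chart_proj) = \sum_l normc (z 0 (lift i l)).
  by rewrite /l1norm big_ord1; apply: eq_bigr => l _; rewrite mulmx_chart_proj.
rewrite /l1norm big_ord1; case: n i z => [[]//|n' i' z'].
by rewrite (bigD1_ord i').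
Qed.

(* On the hyperplane, [z_i] is a combination of the other [z_j]. *)
Lemma l1norm_le_chart_proj x w : x *m chart_covector w = 0 ->
  l1norm (rsubmx x) <= (1 + l1norm w) * l1norm (rsubmx x *m chart_proj).
Proof.
rewrite mulmx_chart_covector; set z := rsubmx x; move=> zw.
rewrite l1norm_lift mulrDl mul1r addrC lerD2l.
have zi : z 0 i = - (z *m chart_proj *m w^T) 0 0.
  move/matrixP/(_ 0 0): zw; rewrite chart_formE linearD /= mulmxDr trmx_mul trmxK.
  rewrite mxE mulmxA trmx_delta -colE [col _ _ _ _]mxE [RHS]mxE.
  by move/eqP; rewrite addr_eq0 => /eqP.
rewrite zi normcN; apply: le_trans (normc_le_l1norm _ _ _) _.
by apply: le_trans (l1normM _ _) _; rewrite l1norm_tr mulrC.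
Qed.

End Charts.

(** * Equations and conormals of the incidence variety off [Yspace] *)

Section Incidence.
Variables (R : realType) (k n : nat) (X : set 'rV[R[i]]_(k + n)) (i : 'I_n).

Definition incidence_map m (g : 'rV[R[i]]_(k + n) -> 'rV[R[i]]_m)
    (q : 'rV[R[i]]_(k + n + n.-1)) : 'rV[R[i]]_(m + 1) :=
  row_mx (g (lsubmx q)) (lsubmx q *m chart_covector k i (rsubmx q)).

(** The last column is the differential of $(x, w) \mapsto l_w(x)$: the form $l_w$ in the $x$
    directions and $z'$ in the $w$ directions. *)
Definition incidence_jacobian m (J : 'M[R[i]]_(k + n, m))
    (q : 'rV[R[i]]_(k + n + n.-1)) : 'M[R[i]]_(k + n + n.-1, m + 1) :=
  row_mx (col_mx J 0)
    (col_mx (chart_covector k i (rsubmx q)) (rsubmx (lsubmx q) *m chart_proj R i)^T).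

Lemma has_diff_incidence m (g : 'rV[R[i]]_(k + n) -> 'rV[R[i]]_m) q J :
  has_diff g (lsubmx q) J -> has_diff (incidence_map g) q (incidence_jacobian J q).
Proof.
move=> gJ; apply: has_diff_row_mx; first exact: has_diff_lsubmx.
move=> e e0; have P0 := l1norm_ge0 (chart_proj R i).
exists (e / (l1norm (chart_proj R i) + 1)) => [|h]; first by rewrite divr_gt0// ltr_wpDl.
rewrite ltr_pdivlMr ?ltr_wpDl// => he.
rewrite (linearD lsubmx) (linearD rsubmx) /= chart_covectorD -{3}[h]hsubmxK.
rewrite bilinear_increment.
apply: le_trans (l1normM _ _) _; rewrite l1norm_tr.
have h1 : l1norm h = l1norm (lsubmx h) + l1norm (rsubmx h) := l1norm_split h.
have h2 : l1norm (lsubmx h) = l1norm (lsubmx (lsubmx h)) + l1norm (rsubmx (lsubmx h)).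
  exact: l1norm_split.
have h3 := l1norm_ge0 (lsubmx (lsubmx h)).
have h4 := l1norm_ge0 (rsubmx (lsubmx h)).
have h5 := l1norm_ge0 (rsubmx h).
apply: ler_pM => //; [exact: l1norm_ge0| |lra].
apply: le_trans (l1normM _ _) _.
apply: (@le_trans _ _ (l1norm h * l1norm (chart_proj R i))); last by lra.
by rewrite ler_wpM2r//; lra.
Qed.

Lemma continuous_incidence_jacobian m (J : 'rV[R[i]]_(k + n) -> 'M[R[i]]_(k + n, m)) q :
  {for lsubmx q, continuous J} ->
  {for q, continuous (fun q => incidence_jacobian (J (lsubmx q)) q)}.
Proof.
move=> /continuous_l1normP Jc; apply: continuous_row_mx.
  apply/continuous_l1normP => e /Jc[d d0 dP]; exists d => // y yd.
  rewrite opp_col_mx add_col_mx subrr l1norm_col_mx l1norm0 addr0; apply: dP.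
  by apply: le_lt_trans yd; rewrite -linearB /= (l1norm_split (y - q)) lerDl l1norm_ge0.
apply: (@continuous_lipschitz _ _ _ _ _ _ _ (l1norm (chart_proj R i))) => y.
set h := y - q; have -> : y = q + h by rewrite /h addrC subrK.
move: h => {y} h.
rewrite (linearD lsubmx) /= !(linearD rsubmx) /= chart_covectorD mulmxDl (linearD trmx) /=.
rewrite opp_col_mx add_col_mx addrAC subrr add0r addrAC subrr add0r.
rewrite !l1norm_col_mx l1norm0 add0r l1norm_tr (l1norm_split h) (l1norm_split (lsubmx h)).
have h1 := l1normM (rsubmx (lsubmx h)) (chart_proj R i).
have h2 := l1normM (chart_proj R i) (rsubmx h)^T; rewrite l1norm_tr in h2.
have h3 : 0 <= l1norm (chart_proj R i) * l1norm (lsubmx (lsubmx h)).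
  by rewrite mulr_ge0 ?l1norm_ge0.
by lra.
Qed.

(** The conormals in the form $(c, b z')$ with $c = a\,dg + b\,l_w$. *)
Lemma incidence_jacobian_tr m (J : 'M[R[i]]_(k + n, m)) q a b :
  row_mx a b%:M *m (incidence_jacobian J q)^T =
  row_mx (a *m J^T + b *: (chart_covector k i (rsubmx q))^T)
         (b *: (rsubmx (lsubmx q) *m chart_proj R i)).
Proof.
rewrite /incidence_jacobian; set c := chart_covector k i _.
rewrite tr_row_mx mul_row_col (tr_col_mx J) (tr_col_mx c) !mul_mx_row add_row_mx.
rewrite trmx0 mulmx0 add0r.
by rewrite trmxK !mul_scalar_mx.
Qed.

Lemma chart_Xtilde x w : Xtilde X (chart i (row_mx x w)) <->
  X x /\ x *m chart_covector k i w = 0.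
Proof.
rewrite /Xtilde /chart row_mxKl row_mxKr; split=> [[[_ /= /mem_chart_hyperplane]]|[Xx xw]].
  by move=> ? ?.
split=> //; split=> /=; first exact: chart_hyperplane_dualP.
exact/mem_chart_hyperplane.
Qed.

(** For the rank: on the hyperplane $z \neq 0$ forces $z' \neq 0$, so a vanishing conormal has $b =
    0$, and then $a = 0$ because the components of $dg$ are independent. *)
Lemma incidence_submersive m (g : 'rV[R[i]]_(k + n) -> 'rV[R[i]]_m) x w :
  submersive_equations X x g -> x *m chart_covector k i w = 0 -> rsubmx x != 0 ->
  submersive_equations (chart i @^-1` Xtilde X) (row_mx x w) (incidence_map g) /\
  'J (incidence_map g) (row_mx x w) = incidence_jacobian ('J g x) (row_mx x w).
Proof.
move=> [Xx [U [oU Ux gU XU rkg]]] xw z0; set q := row_mx x w.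
have [r r0 rU] : exists2 r : R, 0 < r & forall y, l1norm (y - x) < r -> U y.
  by apply/nbhs_l1normP; exact: open_nbhs_nbhs.
have lU y : l1norm (y - q) < r -> U (lsubmx y).
  move=> yr; apply: rU; apply: le_lt_trans yr.
  by rewrite (l1norm_split (y - q)) linearB /= row_mxKl lerDl l1norm_ge0.
have qr : l1norm (q - q) < r by rewrite subrr l1norm0.
have dg y : l1norm (y - q) < r ->
    has_diff (incidence_map g) y (incidence_jacobian ('J g (lsubmx y)) y).
  by move=> /lU/gU[dg _]; apply: has_diff_incidence; exact: differentiable_has_diff.
have Jq : 'J (incidence_map g) q = incidence_jacobian ('J g x) q.
  by rewrite (has_diff_jacobian (dg q qr)) row_mxKl.
split=> //; split; first exact/chart_Xtilde.
exists [set y | l1norm (y - q) < r]; split.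
- exact: l1ball_open.
- exact: qr.
- apply: (@holomorphic_onI _ _ _ _ _
    (fun y => incidence_jacobian ('J g (lsubmx y)) y)) => [|y|y].
  + exact: l1ball_open.
  + exact: dg.
  + by move=> /lU/gU[_ Jc]; exact: continuous_incidence_jacobian.
- move=> y /lU/XU Xy; rewrite -{1}[y]hsubmxK /= chart_Xtilde Xy /incidence_map.
  split=> [[-> ->]|/eqP]; first by rewrite row_mx0.
  by rewrite row_mx_eq0 => /andP[/eqP ? /eqP].
- rewrite Jq; apply/rank_full_colP => c.
  rewrite -[c]hsubmxK [rsubmx c]mx11_scalar incidence_jacobian_tr.
  set a := lsubmx c; set b := rsubmx c 0 0.
  rewrite row_mxKl row_mxKr => /eqP; rewrite row_mx_eq0 => /andP[ab].
  rewrite scaler_eq0 => /orP[/eqP b0|/eqP zP]; last first.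
    have := l1norm_le_chart_proj xw; rewrite zP l1norm0 mulr0 leNgt.
    by rewrite l1norm_gt0.
  move: ab; rewrite b0 scale0r addr0 => /eqP aJ.
  by rewrite (proj1 (rank_full_colP _) rkg a aJ) raddf0 row_mx0.
Qed.

(** Near a point with submersive equations every point of [Xtilde X] is smooth, so passing to the
    smooth points does not change the germ. *)
Lemma incidence_smooth_submersive m (g : 'rV[R[i]]_(k + n) -> 'rV[R[i]]_m) x w :
  submersive_equations X x g -> x *m chart_covector k i w = 0 -> rsubmx x != 0 ->
  submersive_equations (chart i @^-1` smooth_points_P (Xtilde X)) (row_mx x w)
    (incidence_map g).
Proof.
move=> Xg xw z0; have [Sg _] := incidence_submersive Xg xw z0.
have [r r0 rP] := submersive_equations_near Sg.
apply: (submersive_equations_congr r0) Sg => q /rP[_ qS]; split.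
  by move=> [j [q' [qq' [d [m' [f [_ [Sq' _]]]]]]]]; rewrite /preimage /= -qq'.
by move=> /qS/submersive_smooth Sq; exists i, q.
Qed.

End Incidence.

(** Here [Z], [Z'], [G], [B], [L], [V] stand for the norms of $z$, $z'$, $c$, $b$, $c_Y$ and $(c, b
    z')$. Dividing [B * Z' <= P0 * V * Z'] by [Z'] gives [B <= P0 * (G + B * Z')]; as [Z'] is small
    the last term is absorbed, so [B <= 2 * P0 * G]. Then [V <= 2 * G], which bounds [L]. *)
Lemma W_generic_arith (R : realFieldType) (n k C0 W P0 Q0 Z Z' G B L V D : R) :
  P0 = n * C0 * W -> Q0 = k * C0 -> 0 <= P0 -> 0 <= Q0 -> 0 <= n -> 0 <= k -> 0 < C0 ->
  0 <= W -> 0 < Z' -> Z' <= Z -> Z <= W * Z' -> 0 <= G -> 0 <= B -> Z' <= 1 / (2 * (P0 + 1)) ->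
  V = G + B * Z' -> D = C0 * Z * V -> L <= k * D -> B * Z' <= n * D ->
  B <= (2 * P0 + 2 * Q0 + 1) * G /\ L <= (2 * P0 + 2 * Q0 + 1) * Z * G.
Proof.
move=> P0E Q0E P00 Q00 n0 k0 C00 W0 Z'0 Z'Z ZW G0 B0 Z'P VE DE LD BD.
have V0 : 0 <= V by rewrite VE addr_ge0// mulr_ge0// ltW.
have h1 : B * Z' <= P0 * V * Z'.
  apply: le_trans BD _; rewrite DE P0E.
  have : 0 <= n * C0 * V * (W * Z' - Z).
    by rewrite mulr_ge0 ?subr_ge0// !mulr_ge0// ltW.
  lra.
have h2 : B <= P0 * V by rewrite -(ler_pM2r Z'0).
have h3 : Z' * (2 * (P0 + 1)) <= 1 by rewrite -ler_pdivlMr// mulr_gt0//; lra.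
have h4 : B * (Z' * (2 * (P0 + 1))) <= B * 1 by rewrite ler_wpM2l.
have h5 : 0 <= B * Z' by rewrite mulr_ge0// ltW.
have h6 : B <= 2 * P0 * G by rewrite VE in h2; lra.
have h7 : B * Z' <= G.
  have a1 : B * Z' <= 2 * P0 * G * Z' by rewrite ler_wpM2r// ltW.
  have a2 : G * (Z' * (2 * (P0 + 1))) <= G * 1 by rewrite ler_wpM2l.
  have a3 : 0 <= G * Z' by rewrite mulr_ge0// ltW.
  lra.
have P0G : 0 <= P0 * G by rewrite mulr_ge0.
have Q0G : 0 <= Q0 * G by rewrite mulr_ge0.
split; first by lra.
apply: le_trans LD _; rewrite DE.
have Z0 : 0 <= Z by apply: le_trans Z'Z; exact: ltW.
have a1 : Q0 * Z * V <= Q0 * Z * (2 * G).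
  by rewrite ler_wpM2l ?mulr_ge0// VE; lra.
have a2 : 0 <= P0 * Z * G by rewrite !mulr_ge0.
have a3 : 0 <= Z * G by rewrite mulr_ge0.
rewrite Q0E in a1 *; lra.
Qed.

(** * Conormal estimates from W-genericity *)

Section WGenericEstimate.
Variables (R : realType) (k n : nat) (X : set 'rV[R[i]]_(k + n)) (i : 'I_n).

(** The matrix selects the $z$ block of [q], read as $((y, z), w)$. *)
Lemma chart_Yspace (q : 'rV[R[i]]_(k + n + n.-1)) :
  (Yspace R k n `*` dualP R k n) (chart i q) <-> q *m col_mx (col_mx 0 1%:M) 0 = 0.
Proof.
rewrite -{2}[q]hsubmxK mul_row_col mulmx0 addr0.
rewrite -{1}[lsubmx q]hsubmxK mul_row_col mulmx0 add0r mulmx1.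
by split=> [[]//|q0]; split=> //=; exact: chart_hyperplane_dualP.
Qed.

Lemma tangent_chart_Yspace q : (Yspace R k n `*` dualP R k n) (chart i q) ->
  exists2 A : {vspace 'rV[R[i]]_(k + n + n.-1)},
    tangent_space (chart i @^-1` (Yspace R k n `*` dualP R k n)) q A &
    forall v, v \in A <-> v *m col_mx (col_mx 0 1%:M) (0 : 'M[R[i]]_(n.-1, n)) = 0.
Proof.
move=> /chart_Yspace qY.
have rkE : \rank (col_mx (col_mx 0 1%:M) 0 : 'M[R[i]]_(k + n + n.-1, n)) = n.
  apply/rank_full_colP => a; rewrite tr_col_mx tr_col_mx !trmx0 trmx1 !mul_mx_row.
  rewrite mulmx0 mulmx1 => /eqP; rewrite row_mx_eq0 => /andP[].
  by rewrite row_mx_eq0 => /andP[_ /eqP].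
have SE := submersive_mulmxr rkE qY.
have SY : submersive_equations (chart i @^-1` (Yspace R k n `*` dualP R k n)) q
    (mulmxr (col_mx (col_mx 0 1%:M) 0)).
  by apply: (submersive_equations_congr ltr01) SE => x _; exact: chart_Yspace.
have [A tA] := tangent_space_ex SY.
exists A => // v; rewrite (tangent_spaceP SY tA).
by rewrite (has_diff_jacobian (has_diff_mulmxr _ _)).
Qed.

(** Test the distance on the coordinate vector [delta_mx 0 j] and the conjugate of [c], which is
    Hermitian orthogonal to [B]. *)
Lemma normal_entry_bound N (A B : {vspace 'rV[R[i]]_N}) (c : 'rV[R[i]]_N) K j :
  dist A B <= K -> delta_mx 0 j \in A ->
  (forall b, b \in B -> b *m c^T = 0) ->
  normc (c 0 j) <= K * l1norm c.
Proof.
move=> ABK jA cB; set v := map_mx (@conjc R) c.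
have vK : map_mx (@conjc R) v = c by apply/rowP => l; rewrite !mxE conjcK.
have vB b : b \in B -> hdot b v = 0.
  by move=> /cB bc; rewrite hdotE vK bc mxE.
have := le_dist jA vB; rewrite hdotE vK -rowE [row _ _ _ _]mxE mxE.
move=> /le_trans; apply.
have lv : l1norm v = l1norm c by rewrite l1norm_conj.
have h1 : hnorm v <= l1norm c by rewrite -lv hnorm_le_l1norm.
have h2 : hnorm (delta_mx 0 j : 'rV[R[i]]_N) <= 1.
  apply: le_trans (hnorm_le_l1norm _) _.
  rewrite /l1norm big_ord1 (bigD1 j)//= mxE !eqxx ComplexField.Normc.normc1.
  rewrite big1 ?addr0// => l lj.
  by rewrite mxE (negPf lj) andbF ComplexField.Normc.normc0.
have K0 := dist_ge0 A B.
apply: ler_pM => //; first by rewrite mulr_ge0 ?hnorm_ge0.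
by apply: le_trans h1; rewrite ler_piMl ?hnorm_ge0.
Qed.

Lemma l1norm_le_entries N (v : 'rV[R[i]]_N) (D : R) :
  (forall j, normc (v 0 j) <= D) -> l1norm v <= N%:R * D.
Proof.
move=> vD; rewrite /l1norm big_ord1 mulr_natl -[X in _ *+ X]card_ord -sumr_const.
by apply: ler_sum.
Qed.

(* [(c, b z')] is conormal to the incidence variety at [(x, w)]; the Y and w
   components of conormals are small by W-genericity. *)
Lemma W_generic_estimate w0 :
  condition_W (chart i @^-1` smooth_points_P (Xtilde X))
    (chart i @^-1` (Yspace R k n `*` dualP R k n)) (row_mx 0 w0) ->
  exists2 C : R, 0 < C & exists2 r : R, 0 < r &
    forall m (g : 'rV[R[i]]_(k + n) -> 'rV[R[i]]_m) x w (a : 'rV[R[i]]_m) (b : R[i]),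
    l1norm x < r -> l1norm (w - w0) < r -> rsubmx x != 0 ->
    x *m chart_covector k i w = 0 -> submersive_equations X x g ->
    let c := a *m ('J g x)^T + b *: (chart_covector k i w)^T in
    normc b <= C * l1norm c /\ l1norm (lsubmx c) <= C * l1norm (rsubmx x) * l1norm c.
Proof.
move=> [_ [U /nbhs_l1normP[r0 r00 r0U] [C0 C00 [_ _ WC]]]].
pose P0 : R := n.-1%:R * C0 * (2 + l1norm w0).
have w00 := l1norm_ge0 w0.
have P00 : 0 <= P0 by rewrite /P0 mulr_ge0 ?mulr_ge0 ?addr_ge0// ltW.
pose Q0 : R := k%:R * C0.
have Q00 : 0 <= Q0 by rewrite /Q0 mulr_ge0// ltW.
exists (2 * P0 + 2 * Q0 + 1); first by lra.
(* The 1 bounds [l1norm w] by [1 + l1norm w0], [r0 / 2] puts both points compared into [U], and the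
   last term lets [P0 |b| |z'|] be absorbed. *)
exists (Num.min (Num.min 1 (r0 / 2)) (1 / (2 * (P0 + 1)))).
  by rewrite !lt_min ltr01 !divr_gt0// mulr_gt0//; lra.
move=> m g x w a b; rewrite !lt_min => /andP[/andP[_ xr0] xP] /andP[/andP[w1 wr0] _].
move=> z0 xw Xg c.
set z := rsubmx x in z0 *; set z' := z *m chart_proj R i.
have zlx : l1norm z <= l1norm x by rewrite (l1norm_split x) lerDr l1norm_ge0.
have z'z : l1norm z' <= l1norm z.
  by rewrite (l1norm_lift i z) lerDr normc_ge0.
have z'0 := l1norm_ge0 z'.
have zz' : l1norm z <= (2 + l1norm w0) * l1norm z'.
  apply: le_trans (l1norm_le_chart_proj xw) _; rewrite ler_wpM2r//.
  have := l1normD (w - w0) w0; rewrite subrK; lra.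
(* [t] is [s] with its $z$ block replaced by 0, so that [s - t] has norm [l1norm z]. *)
pose s := row_mx x w; pose t := row_mx (row_mx (lsubmx x) 0) w : 'rV[R[i]]_(k + n + n.-1).
have Sg := incidence_smooth_submersive Xg xw z0.
have [_ JE] := incidence_submersive Xg xw z0.
have sU : U s.
  by apply: r0U; rewrite /s opp_row_mx add_row_mx subr0 l1norm_row_mx; lra.
have lx : l1norm (lsubmx x) <= l1norm x by rewrite (l1norm_split x) lerDl l1norm_ge0.
have tU : U t.
  apply: r0U; rewrite /t opp_row_mx add_row_mx subr0 l1norm_row_mx.
  by rewrite l1norm_row_mx l1norm0; lra.
have tY : (Yspace R k n `*` dualP R k n) (chart i t).
  by apply/chart_Yspace; rewrite mul_row_col mulmx0 addr0 mul_row_col mulmx0 mul0mx addr0.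
have [A tA AE] := tangent_chart_Yspace tY.
have [B tB] := tangent_space_ex Sg.
have BE := tangent_spaceP Sg tB.
have st : hnorm (s - t) <= l1norm z.
  apply: le_trans (hnorm_le_l1norm _) _.
  rewrite /s /t -[x in row_mx x w - _]hsubmxK !opp_row_mx !add_row_mx !subrr subr0.
  by rewrite !l1norm_row_mx !l1norm0 add0r addr0.
have distAB : dist A B <= C0 * l1norm z.
  apply: le_trans (WC s t A B (conj Sg.1 sU) (conj tY tU) tA tB) _.
  by rewrite ler_wpM2l// ltW.
pose v := row_mx c (b *: z').
have vB u : u \in B -> u *m v^T = 0.
  have -> : v = row_mx a b%:M *m ('J (incidence_map i g) s)^T.
    by rewrite JE incidence_jacobian_tr row_mxKl row_mxKr.
  by move=> /BE uJ; rewrite trmx_mul trmxK mulmxA uJ mul0mx.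
set D := C0 * l1norm z * l1norm v.
have vD j : delta_mx 0 j \in A -> normc (v 0 j) <= D.
  by move=> jA; exact: normal_entry_bound distAB jA vB.
(* The $y$ and $w$ coordinate vectors are tangent to $z = 0$, so the entries of [v] in these
   directions are at most [D]. *)
have lcD : l1norm (lsubmx c) <= k%:R * D.
  apply: l1norm_le_entries => j.
  have -> : lsubmx c 0 j = v 0 (lshift _ (lshift _ j)) by rewrite row_mxEl mxE.
  apply: vD; apply/AE; rewrite -rowE; apply/rowP => l.
  by rewrite [LHS]mxE col_mxEu col_mxEu !mxE.
have bzD : l1norm (b *: z') <= n.-1%:R * D.
  apply: l1norm_le_entries => j.
  have -> : (b *: z') 0 j = v 0 (rshift _ j) by rewrite row_mxEr.
  apply: vD; apply/AE; rewrite -rowE; apply/rowP => l.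
  by rewrite [LHS]mxE col_mxEd !mxE.
have vE : l1norm v = l1norm c + normc b * l1norm z' by rewrite l1norm_row_mx l1normZ.
rewrite l1normZ in bzD.
have z'gt0 : 0 < l1norm z'.
  rewrite lt_def z'0 andbT; apply/eqP => z'E; move: zz'; rewrite z'E mulr0 leNgt.
  by rewrite l1norm_gt0.
apply: (@W_generic_arith _ n.-1%:R k%:R C0 (2 + l1norm w0) P0 Q0
  _ (l1norm z') _ _ _ (l1norm v) D) => //.
- by lra.
- exact: l1norm_ge0.
- exact: normc_ge0.
- by lra.
Qed.

End WGenericEstimate.

(** * Hyperplane sections and the position of a smooth germ relative to [Yspace] *)

Section LinearSections.
Variable R : realType.

Lemma submersive_section N m q (S : set 'rV[R[i]]_N) p (g : 'rV[R[i]]_N -> 'rV[R[i]]_m)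
    (L : 'M[R[i]]_(N, q)) :
  submersive_equations S p g -> p *m L = 0 -> \rank (row_mx ('J g p) L) = (m + q)%N ->
  submersive_equations (S `&` [set x | x *m L = 0]) p (fun x => row_mx (g x) (x *m L)) /\
  'J (fun x => row_mx (g x) (x *m L)) p = row_mx ('J g p) L.
Proof.
move=> [Sp [U [oU Up gU SU rkg]]] pL rkL.
have dg y : U y -> has_diff (fun x => row_mx (g x) (x *m L)) y (row_mx ('J g y) L).
  move=> /gU[dg _]; apply: (@has_diff_row_mx _ _ _ _ _ (mulmxr L)).
    exact: differentiable_has_diff.
  exact: has_diff_mulmxr.
have JE := has_diff_jacobian (dg p Up).
split=> //; split=> //; exists U; split; [exact: oU|exact: Up| | |by rewrite JE].
  apply: (@holomorphic_onI _ _ _ _ _ (fun y => row_mx ('J g y) L)) => //.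
  move=> y /gU[_ Jc]; apply: continuous_row_mx => //.
  by apply: (@continuous_lipschitz _ _ _ _ _ _ _ 0) => x; rewrite subrr l1norm0 mul0r.
move=> x /SU Sx; rewrite /= /setI /= Sx; split=> [[-> ->]|/eqP]; first by rewrite row_mx0.
by rewrite row_mx_eq0 => /andP[/eqP ? /eqP].
Qed.

Lemma rank_row_covectorP N m (J : 'M[R[i]]_(N, m)) (l : 'cV[R[i]]_N) :
  \rank (row_mx J l) = (m + 1)%N <->
  forall (a : 'rV_m) (b : R[i]), a *m J^T + b *: l^T = 0 -> a = 0 /\ b = 0.
Proof.
have E (a : 'rV_m) (b : R[i]) : row_mx a b%:M *m (row_mx J l)^T = a *m J^T + b *: l^T.
  by rewrite tr_row_mx mul_row_col mul_scalar_mx.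
rewrite rank_full_colP; split=> [h a b ab|h c].
  have := h (row_mx a b%:M); rewrite E ab => /(_ erefl)/eqP.
  rewrite row_mx_eq0 => /andP[/eqP -> /eqP/matrixP/(_ 0 0)].
  by rewrite !mxE eqxx mulr1n.
rewrite -[c]hsubmxK [rsubmx c]mx11_scalar E => /h[-> ->].
by rewrite raddf0 row_mx0.
Qed.

Lemma submersive_Yspace k n (p : 'rV[R[i]]_(k + n)) : rsubmx p = 0 ->
  submersive_equations (Yspace R k n) p (mulmxr (col_mx 0 1%:M)).
Proof.
have E (x : 'rV[R[i]]_(k + n)) : x *m col_mx 0 1%:M = rsubmx x.
  by rewrite -{1}[x]hsubmxK mul_row_col mulmx0 add0r mulmx1.
move=> p0; have : submersive_equations
    [set x : 'rV[R[i]]_(k + n) | x *m col_mx 0 1%:M = 0] p (mulmxr (col_mx 0 1%:M)).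
  apply: submersive_mulmxr; last by rewrite E.
  apply/rank_full_colP => a; rewrite tr_col_mx trmx0 trmx1 mul_mx_row mulmx0 mulmx1.
  by move=> /eqP; rewrite row_mx_eq0 => /andP[_ /eqP].
by apply: (submersive_equations_congr ltr01) => x _; rewrite /Yspace /= E.
Qed.

Lemma tangent_Yspace k n (t : 'rV[R[i]]_(k + n)) A :
  Yspace R k n t -> tangent_space (Yspace R k n) t A -> forall u, u \in A -> rsubmx u = 0.
Proof.
move=> /submersive_Yspace tY tA u /(tangent_spaceP tY tA).
rewrite (has_diff_jacobian (has_diff_mulmxr _ _)).
by rewrite -{1}[u]hsubmxK mul_row_col mulmx0 add0r mulmx1.
Qed.

(** Compare $x = (y, z)$ in [X] with $(y, 0)$. Both are zeros of [g], so strict differentiability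
    makes the image of $(0, z)$ under the differential small against $z$; the differential is
    injective on such vectors, hence $z = 0$. *)
Lemma locally_Yspace k n (X : set 'rV[R[i]]_(k + n)) s m
    (g : 'rV[R[i]]_(k + n) -> 'rV[R[i]]_m) (r : R) : 0 < r ->
  submersive_equations X s g -> rsubmx s = 0 ->
  (forall v : 'rV_(k + n), v *m 'J g s = 0 -> rsubmx v = 0) ->
  (forall y : 'rV_(k + n), l1norm (y - s) < r -> rsubmx y = 0 -> X y) ->
  exists2 d : R, 0 < d & forall x : 'rV_(k + n),
    l1norm (x - s) < d -> X x -> rsubmx x = 0.
Proof.
move=> r0 [Xs [U [oU Us gU XU _]]] s0 kerY YX.
have [r1 r10 rU] : exists2 r : R, 0 < r & forall x, l1norm (x - s) < r -> U x.
  by apply/nbhs_l1normP; exact: open_nbhs_nbhs.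
pose K : 'M[R[i]]_(n, k + n) := row_mx 0 1%:M.
(* [K] includes the $z$ space; [P] inverts the differential restricted to it. *)
have /row_freeP[P KJP] : row_free (K *m 'J g s).
  rewrite -kermx_eq0; apply/eqP/row_matrixP => j; rewrite row0.
  have /kerY : row j (kermx (K *m 'J g s)) *m K *m 'J g s = 0.
    by rewrite -mulmxA -row_mul mulmx_ker row0.
  by rewrite mul_mx_row row_mxKr mulmx1.
have P0 := l1norm_ge0 P.
have e0 : 0 < 1 / (2 * (l1norm P + 1)) by rewrite divr_gt0// mulr_gt0//; lra.
have [d d0 dP] := holomorphic_strict_diff oU Us gU e0.
exists (Num.min (Num.min r r1) d) => [|x]; first by rewrite !lt_min r0 r10.
rewrite !lt_min => /andP[/andP[xr xr1] xd] Xx.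
set z := rsubmx x; pose y : 'rV[R[i]]_(k + n) := row_mx (lsubmx x) 0.
have ys : l1norm (y - s) <= l1norm (x - s).
  rewrite /y -[s]hsubmxK s0 -{2}[x]hsubmxK !opp_row_mx !add_row_mx !l1norm_row_mx.
  by rewrite subrr l1norm0 addr0 lerDl l1norm_ge0.
have xy : x - y = z *m K.
  rewrite /y -{1}[x]hsubmxK opp_row_mx add_row_mx subrr subr0 mul_mx_row mulmx0.
  by rewrite mulmx1.
have Xy : X y by apply: YX; [lra|rewrite row_mxKr].
have gx : g x = 0 by apply/XU => //; exact: rU.
have gy : g y = 0 by apply/XU => //; apply: rU; lra.
have := dP x y xd; rewrite gx gy subrr add0r l1normN xy => /(_ (le_lt_trans ys xd)).
have -> : l1norm (z *m K) = l1norm z.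
  by rewrite mul_mx_row mulmx0 mulmx1 l1norm_row_mx l1norm0 add0r.
move=> h1.
have h2 : l1norm z <= l1norm (z *m K *m 'J g s) * l1norm P.
  by rewrite -{1}[z]mulmx1 -KJP !mulmxA l1normM.
have z0 := l1norm_ge0 z.
apply: l1norm_eq0; apply/eqP; rewrite eq_le z0 andbT.
have h3 : l1norm (z *m K *m 'J g s) * l1norm P <=
    1 / (2 * (l1norm P + 1)) * l1norm z * l1norm P.
  by rewrite ler_wpM2r.
have h4 : 1 / (2 * (l1norm P + 1)) * l1norm P <= 1 / 2.
  rewrite mulrAC ler_pdivrMr ?mulr_gt0//; lra.
have h5 : 1 / (2 * (l1norm P + 1)) * l1norm P * l1norm z <= 1 / 2 * l1norm z.
  by rewrite ler_wpM2r.
rewrite mulrAC in h3; lra.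
Qed.

(* A secant tangent to the hyperplane [w0] meets nearby hyperplanes [w]: tilt one
   coefficient of the hyperplane by the defect of the secant point. *)
Lemma secant_in_nearby_hyperplane k n (i : 'I_n) (X : set 'rV[R[i]]_(k + n)) s v w0
    (eta : R) :
  secant_direction X s v -> rsubmx s = 0 -> v *m chart_covector k i w0 = 0 ->
  rsubmx v != 0 -> 0 < eta -> exists x w,
    [/\ X x, l1norm (x - s) < eta, l1norm (w - w0) < eta, rsubmx x != 0
      & x *m chart_covector k i w = 0].
Proof.
move=> Xv s0 vl v0 eta0; set l := chart_covector k i w0.
pose zc (y : 'rV[R[i]]_(k + n)) := rsubmx y *m chart_proj R i.
have [j vj] : exists j, zc v 0 j != 0.
  apply: contrapT => zv0.
  have zv : zc v = 0.
    apply/rowP => j; rewrite [RHS]mxE; apply: contrapT => vj.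
    by apply: zv0; exists j; apply/eqP.
  have := l1norm_le_chart_proj vl; rewrite -/(zc v) zv l1norm0 mulr0 leNgt.
  by rewrite l1norm_gt0.
set zeta := normc (zc v 0 j).
have zeta0 : 0 < zeta.
  rewrite lt_def normc_ge0 andbT; apply: contra vj => /eqP.
  by move=> /ComplexField.Normc.eq0_normc ->.
have l0 := l1norm_ge0 l; have lv0 := l1norm_ge0 v.
(* The first bound keeps the [j]-th entry of [zc x] at least [t * zeta / 2]; the second keeps the
   tilt below [eta]. *)
pose e := Num.min (zeta / 2) (eta * zeta / (4 * (l1norm l + 1))).
have e0 : 0 < e by rewrite lt_min !divr_gt0 ?mulr_gt0//; lra.
have e1 : e <= zeta / 2 by rewrite ge_min lexx.
have e2 : e * (4 * (l1norm l + 1)) <= eta * zeta.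
  by rewrite -ler_pdivlMr ?ge_min ?lexx ?orbT// mulr_gt0//; lra.
have [d d0 dP] := Xv e e0.
have D0 : 0 < l1norm v + e + 1 by lra.
pose t := Num.min (d / 2) (eta / (l1norm v + e + 1) / 2).
have t0 : 0 < t by rewrite lt_min !divr_gt0.
have td : t < d by rewrite gt_min; apply/orP; left; lra.
have teta : t * (l1norm v + e + 1) <= eta / 2.
  by rewrite -ler_pdivlMr// mulrAC ge_min lexx orbT.
have [|x Xx xt] := dP t; first by rewrite t0.
pose h := x - (s + t%:C *: v).
have hE : x = s + t%:C *: v + h by rewrite /h addrC subrK.
have ht : l1norm h <= e * t by [].
have sl : s *m l = 0 by rewrite mulmx_chart_covector s0 mul0mx.
(* The defect of [x] comes from [h] only, so it is at most [e * t * l1norm l], while the entry it is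
   divided by has order [t]. *)
have xl : x *m l = h *m l by rewrite hE !mulmxDl sl -scalemxAl vl scaler0 !add0r.
have zx : zc x 0 j = t%:C * zc v 0 j + zc h 0 j.
  have zcE y : zc y 0 j = y 0 (rshift k (lift i j)) by rewrite /zc mulmx_chart_proj mxE.
  have sj : s 0 (rshift k (lift i j)) = 0 by move/rowP/(_ (lift i j)): s0; rewrite !mxE.
  by rewrite !zcE {1}hE [LHS]mxE [(s + _) _ _]mxE sj add0r [X in X + _]mxE.
have zh : normc (zc h 0 j) <= e * t.
  rewrite /zc mulmx_chart_proj; apply: le_trans ht; rewrite (l1norm_split h).
  apply: le_trans (normc_le_l1norm _ _ _) _; by rewrite lerDr l1norm_ge0.
have zxge : t * zeta / 2 <= normc (zc x 0 j).
  have -> : t * zeta / 2 = t * zeta - t * (zeta / 2) by lra.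
  have -> : t * zeta = normc (zc x 0 j + - zc h 0 j).
    by rewrite zx addrK ComplexField.Normc.normcM normc_real gtr0_norm.
  have := le_normcD (zc x 0 j) (- zc h 0 j); rewrite normcN.
  have : e * t <= zeta / 2 * t by rewrite ler_wpM2r// ltW.
  lra.
have tz : 0 < t * zeta / 2 by rewrite divr_gt0// mulr_gt0.
have zx0 : zc x 0 j != 0.
  apply/eqP => zx0; move: zxge; rewrite zx0 ComplexField.Normc.normc0; lra.
(* Adding [b] to the [j]-th chart coefficient cancels the defect of [x] exactly. *)
pose b := - (x *m l) 0 0 / zc x 0 j.
pose dw : 'rV[R[i]]_n.-1 := b *: delta_mx 0 j.
exists x, (w0 + dw); split=> //.
- have -> : x - s = t%:C *: v + h by rewrite {1}hE -[s + _ + h]addrA addrAC subrr add0r.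
  apply: le_lt_trans (l1normD _ _) _; rewrite l1normZ normc_real gtr0_norm//; lra.
- have -> : w0 + dw - w0 = dw by rewrite addrAC subrr add0r.
  have -> : l1norm dw = normc b.
    rewrite l1normZ -[RHS]mulr1; congr (_ * _).
    rewrite /l1norm big_ord1 (bigD1 j)//= mxE !eqxx ComplexField.Normc.normc1.
    rewrite big1 ?addr0// => l' lj.
    by rewrite mxE (negPf lj) andbF ComplexField.Normc.normc0.
  rewrite /b ComplexField.Normc.normcM ComplexField.Normc.normcV normcN.
  rewrite ltr_pdivrMr; last by lra.
  have h1 : normc ((x *m l) 0 0) <= e * t * l1norm l.
    apply: le_trans (normc_le_l1norm _ _ _) _; rewrite xl.
    by apply: le_trans (l1normM _ _) _; rewrite ler_wpM2r.
  have h2 : eta * (t * zeta / 2) <= eta * normc (zc x 0 j) by rewrite ler_wpM2l// ltW.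
  have h3 : e * (4 * (l1norm l + 1)) * t <= eta * zeta * t by rewrite ler_wpM2r// ltW.
  have h4 : 0 < e * t by rewrite mulr_gt0.
  have h5 : 0 <= e * t * l1norm l by rewrite mulr_ge0// ltW.
  lra.
- apply: contra zx0 => /eqP zx0; rewrite /zc zx0 mul0mx mxE; exact: eqxx.
- rewrite chart_covectorD mulmxDr -{2}[x]hsubmxK mul_row_col mulmx0 add0r mulmxA.
  rewrite -/(zc x) /dw linearZ /= -scalemxAr trmx_delta -colE.
  apply/rowP => j'; rewrite ord1 [LHS]mxE [X in _ + X]mxE [col _ _ _ _]mxE [RHS]mxE.
  by rewrite /b mulfVK// addrN.
Qed.

End LinearSections.

(** * Smoothness of the section at points of [Yspace] *)

Lemma conormal_increment (K : comPzRingType) N m (J J' : 'M[K]_(N, m)) (l l' : 'cV[K]_N)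
    (a : 'rV_m) b : a *m J^T + b *: l^T = 0 ->
  a *m J'^T + b *: l'^T = a *m (J' - J)^T + b *: (l' - l)^T.
Proof.
by move=> ab; rewrite !(linearB trmx) /= mulmxBr scalerBr addrACA -opprD ab subr0.
Qed.

Section SmoothnessAlongY.
Variables (R : realType) (k n : nat) (X : set 'rV[R[i]]_(k + n)) (i : 'I_n).
Variables (w0 : 'rV[R[i]]_n.-1) (C r : R).
Local Notation l := (chart_covector k i w0).

(** For positive [C] and [b = 1], this keeps $l_w$ at distance at least $1/C$ from the conormals of
    [X]. Uniformity in $w$ near [w0] is what allows the hyperplane to be tilted. *)
Definition uniformly_transverse :=
  forall m (g : 'rV[R[i]]_(k + n) -> 'rV[R[i]]_m) x (w : 'rV[R[i]]_n.-1)
    (a : 'rV[R[i]]_m) (b : R[i]),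
  l1norm x < r -> l1norm (w - w0) < r -> rsubmx x != 0 ->
  x *m chart_covector k i w = 0 -> submersive_equations X x g ->
  normc b <= C * l1norm (a *m ('J g x)^T + b *: (chart_covector k i w)^T).

(** If $b \neq 0$, the relation makes $l$ vanish on [v], so a tilted hyperplane meets [X] off
    [Yspace] arbitrarily near [s]. There the same [a] and [b] give a conormal close to 0, against
    the lower bound [normc b / C]. *)
Lemma not_tangent_off_Yspace m (g : 'rV[R[i]]_(k + n) -> 'rV[R[i]]_m)
    (s v : 'rV[R[i]]_(k + n)) (a : 'rV[R[i]]_m) (b : R[i]) :
  0 < C -> 0 < r -> uniformly_transverse ->
  submersive_equations X s g -> l1norm s < r -> rsubmx s = 0 ->
  v *m 'J g s = 0 -> rsubmx v != 0 -> a *m ('J g s)^T + b *: l^T = 0 -> b = 0.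
Proof.
move=> C0 r0 transverse Xg sr s0 vJ v0 ab; apply: contrapT => /eqP b0.
have vl : v *m l = 0.
  have : b *: (v *m l)^T = 0.
    have := congr1 (fun c => c *m v^T) ab; rewrite mul0mx mulmxDl -mulmxA -trmx_mul vJ.
    by rewrite trmx0 mulmx0 add0r -scalemxAl -trmx_mul.
  move=> /eqP; rewrite scaler_eq0 (negPf b0) /= => /eqP vl.
  by rewrite -[LHS]trmxK vl trmx0.
have nb : 0 < normc b.
  rewrite lt_def normc_ge0 andbT; apply: contra b0 => /eqP.
  by move=> /ComplexField.Normc.eq0_normc ->.
pose P : R := l1norm (chart_proj R i).
have P0 : 0 <= P by exact: l1norm_ge0.
have a0 := l1norm_ge0 a.
pose M := C * (l1norm a + normc b * P) + 1.
have M0 : 0 < M.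
  have : 0 <= C * (l1norm a + normc b * P) by rewrite mulr_ge0 ?addr_ge0 ?mulr_ge0// ltW.
  by rewrite /M; lra.
(* The conormal at the nearby point has norm at most [eps * (l1norm a + normc b * P)], and [C] times
   this is below [normc b / 2]. *)
pose eps := normc b / (2 * M).
have eps0 : 0 < eps by rewrite divr_gt0// mulr_gt0.
have epsM : eps * (2 * M) = normc b by rewrite /eps divfK// gt_eqF// mulr_gt0.
have [Xs [U [_ Us gU _ _]]] := Xg.
have [_ /continuous_l1normP/(_ _ eps0)[d d0 dP]] := gU s Us.
have [d' d'0 d'P] := submersive_equations_near Xg.
pose eta := Num.min (Num.min d d') (Num.min eps (Num.min r (r - l1norm s))).
have eta0 : 0 < eta by rewrite !lt_min d0 d'0 eps0 r0 subr_gt0.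
have [x [w [Xx]]] := secant_in_nearby_hyperplane (kernel_secant Xg vJ) s0 vl v0 eta0.
rewrite !lt_min => /andP[/andP[xd /d'P[_ /(_ Xx) Xgx]] /andP[_ /andP[_ xr]]].
move=> /andP[_ /andP[weps /andP[wr _]]] x0 xw.
have xr' : l1norm x < r by have := l1normD (x - s) s; rewrite subrK; lra.
have := transverse _ _ _ _ a b xr' wr x0 xw Xgx.
have -> : a *m ('J g x)^T + b *: (chart_covector k i w)^T =
    a *m ('J g x - 'J g s)^T + b *: (chart_covector k i w - l)^T.
  exact: conormal_increment.
have lw : l1norm (chart_covector k i w - l) <= P * l1norm (w - w0).
  rewrite -{1}(subrK w0 w) [_ + w0]addrC chart_covectorD.
  rewrite addrAC subrr add0r l1norm_col_mx l1norm0 add0r.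
  by apply: le_trans (l1normM _ _) _; rewrite l1norm_tr.
apply/negP; rewrite -ltNge.
have h1 := l1normD (a *m ('J g x - 'J g s)^T) (b *: (chart_covector k i w - l)^T).
have h2 := l1normM a ('J g x - 'J g s)^T.
rewrite l1normZ !l1norm_tr in h1 h2.
have h3 : l1norm a * l1norm ('J g x - 'J g s) <= l1norm a * eps.
  by rewrite ler_wpM2l// ltW// dP.
have h4 : normc b * l1norm (chart_covector k i w - l) <= normc b * (P * eps).
  rewrite ler_wpM2l ?normc_ge0//; apply: le_trans lw _.
  by rewrite ler_wpM2l// ltW.
apply: (@le_lt_trans _ _ (C * (l1norm a * eps + normc b * (P * eps)))).
  by rewrite ler_wpM2l ?(ltW C0)//; lra.
rewrite /M in epsM; lra.
Qed.

Lemma smooth_section_Yspace Omega (s : 'rV[R[i]]_(k + n)) :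
  0 < C -> 0 < r -> uniformly_transverse -> open Omega ->
  Yspace R k n `&` Omega `<=` X -> Omega s -> smooth_points X s ->
  l1norm s < r -> rsubmx s = 0 ->
  smooth_points (smooth_points X `&` [set x | x *m l = 0]) s /\
  exists2 d : R, 0 < d & forall y : 'rV[R[i]]_(k + n),
    l1norm (y - s) < d -> rsubmx y = 0 ->
    (smooth_points X `&` [set x | x *m l = 0]) y.
Proof.
move=> C0 r0 tr oO YX Os [e [m [g [_ Xg]]]] sr s0.
have [d1 d10 d1P] : exists2 d : R, 0 < d & forall x, l1norm (x - s) < d -> Omega x.
  by apply/nbhs_l1normP; exact: open_nbhs_nbhs.
have [d2 d20 d2P] := submersive_equations_near Xg.
pose d := Num.min d1 d2.
have d0 : 0 < d by rewrite lt_min d10.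
have XYd y : l1norm (y - s) < d -> rsubmx y = 0 -> X y.
  by rewrite lt_min => /andP[/d1P Oy _] y0; apply: YX.
have yl (y : 'rV[R[i]]_(k + n)) : rsubmx y = 0 -> y *m l = 0.
  by move=> y0; rewrite mulmx_chart_covector y0 mul0mx.
have smX y : l1norm (y - s) < d2 -> X y -> smooth_points X y.
  by move=> /d2P[_ /[apply]]; exact: submersive_smooth.
have XYd' y : l1norm (y - s) < d -> rsubmx y = 0 ->
    (smooth_points X `&` [set x | x *m l = 0]) y.
  move=> yd y0; split; last exact: yl.
  by apply: smX; [move: yd; rewrite lt_min => /andP[]|exact: XYd].
split; last by exists d.
(* If the hyperplane is transverse to [X] at [s], the equations of [X] together with $l$ cut out the
   section. Otherwise there is a relation with $b \neq 0$, the tangent space of [X] lies in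
   [Yspace], and [X] and the section both equal [Yspace] near [s]. *)
have [rk|rk] := pselect (\rank (row_mx ('J g s) l) = (m + 1)%N).
  have [Sg _] := submersive_section Xg (yl _ s0) rk.
  apply: submersive_smooth; apply: (submersive_equations_congr d20) Sg => x xd.
  split=> [[[d' [m' [f [_ [Xx _]]]]] xl]|[Xx xl]]; first by split.
  by split=> //; exact: smX.
have [a [b [ab b0]]] : exists a b, a *m ('J g s)^T + b *: l^T = 0 /\ b <> 0.
  apply: contrapT => nab; apply: rk; apply/rank_row_covectorP => a b ab.
  have b0 : b = 0 by apply: contrapT => b0; apply: nab; exists a, b.
  split=> //; have [_ [U [_ _ _ _ rkg]]] := Xg.
  by apply: (proj1 (rank_full_colP _) rkg); rewrite -ab b0 scale0r addr0.
have kerY (v : 'rV[R[i]]_(k + n)) : v *m 'J g s = 0 -> rsubmx v = 0.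
  move=> vJ; apply: contrapT => /eqP v0; apply: b0.
  exact: not_tangent_off_Yspace C0 r0 tr Xg sr s0 vJ v0 ab.
have [d3 d30 d3P] := locally_Yspace d0 Xg s0 kerY XYd.
have SY := submersive_Yspace s0.
have dd0 : 0 < Num.min d d3 by rewrite lt_min d0.
apply: submersive_smooth; apply: (submersive_equations_congr dd0) SY => x.
rewrite lt_min => /andP[xd xd3]; split; last exact: XYd'.
by move=> [[d' [m' [f [_ [Xx _]]]]] _]; exact: d3P.
Qed.

End SmoothnessAlongY.

(** * Condition W for the hyperplane section *)

Theorem mainTheorem4 (R : realType) (k n : nat)
    (Omega X : set 'rV[R[i]]_(k + n)) (H : {vspace 'rV[R[i]]_(k + n)}) :
  open Omega -> Omega 0 ->
  analytic_subset Omega X ->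
  equidimensional_germ X 0 ->
  Yspace R k n `&` Omega `<=` X ->
  condition_W (smooth_points X) (Yspace R k n) 0 ->
  dualP R k n H ->
  W_generic X H ->
  condition_W (smooth_points X `&` [set` H]) (Yspace R k n) 0.
Proof.
move=> oO O0 [XO _] _ YX _ _ [i [p [pE Wp]]].
have [w0 pE'] : exists w0, p = row_mx 0 w0.
  by exists (rsubmx p); rewrite -{1}[p]hsubmxK; congr row_mx; case: pE.
have HE : [set` H] = [set x | x *m chart_covector k i w0 = 0].
  apply/seteqP; split=> x /=; case: pE => _ <-; rewrite pE' row_mxKr.
    by move=> /mem_chart_hyperplane.
  by move=> ?; apply/mem_chart_hyperplane.
rewrite pE' in Wp; have [C C0 [r r0 est]] := W_generic_estimate Wp.
have tr : uniformly_transverse X i w0 C r.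
  by move=> m g x w a b xr wr x0 xw Xg; have [] := est m g x w a b xr wr x0 xw Xg.
rewrite HE; set l := chart_covector k i w0; set S := _ `&` _.
have w0r : l1norm (w0 - w0) < r by rewrite subrr l1norm0.
have off_Y s : l1norm s < r -> S s -> rsubmx s != 0 ->
    exists m (g : 'rV[R[i]]_(k + n) -> 'rV[R[i]]_m), submersive_equations X s g /\
    exists f : 'rV[R[i]]_(k + n) -> 'rV[R[i]]_(m + 1),
      submersive_equations S s f /\ 'J f s = row_mx ('J g s) l.
  move=> sr [[e [m [g [_ Xg]]]] sl] s0; exists m, g; split=> //.
  have rk : \rank (row_mx ('J g s) l) = (m + 1)%N.
    apply/rank_row_covectorP => a b ab.
    (* Uniform transversality at [w = w0], applied to a vanishing conormal. *)
    have b0 : b = 0.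
      apply: ComplexField.Normc.eq0_normc; apply/eqP; rewrite eq_le normc_ge0 andbT.
      by have := tr _ _ _ _ a b sr w0r s0 sl Xg; rewrite ab l1norm0 mulr0.
    split=> //; have [_ [U [_ _ _ _ rkg]]] := Xg.
    by apply: (proj1 (rank_full_colP _) rkg); rewrite -ab b0 scale0r addr0.
  have [Sf Jf] := submersive_section Xg sl rk.
  exists (fun x => row_mx (g x) (x *m l)); split=> //.
  have [d d0 dP] := submersive_equations_near Xg.
  apply: (submersive_equations_congr d0) Sf => x /dP[_ xX].
  split=> [[[d' [m' [f [_ [Xx _]]]]] xl]|[Xx xl]]; first by split.
  by split=> //; exact: submersive_smooth (xX Xx).
have on_Y s : l1norm s < r -> S s -> rsubmx s = 0 -> smooth_points S s /\
    exists2 d : R, 0 < d & forall y : 'rV[R[i]]_(k + n),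
      l1norm (y - s) < d -> rsubmx y = 0 -> S y.
  move=> sr [sX sl] s0; apply: (smooth_section_Yspace C0 r0 tr oO) => //.
  by apply: XO; case: sX => ? [? [? [_ []]]].
split; first by rewrite /Yspace /= raddf0.
exists [set x | l1norm x < r].
  by apply/nbhs_l1normP; exists r => // x; rewrite subr0.
pose N : R := (k + n)%:R; have N0 : 0 <= N by [].
(* Each factor [N] converts one [l1norm], of [u], of [v] or of the $z$ part of [s], into a Hermitian
   norm; the 1 makes the constant positive. *)
exists (N * N * N * C + 1).
  by rewrite ltr_wpDl// !mulr_ge0// ltW.
split=> [s [Ss sr]|t [tY _]|s t A B [Ss sr] [tY _] tA tB].
- have [s0|s0] := eqVneq (rsubmx s) 0; first by have [] := on_Y s sr Ss s0.
  have [m [g [_ [f [Sf _]]]]] := off_Y s sr Ss s0.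
  exact: submersive_smooth Sf.
- by have /submersive_Yspace/submersive_smooth := tY.
have AY := tangent_Yspace tY tA.
have hst := hnorm_ge0 (s - t).
have K0 : 0 <= N * N * N * C * hnorm (s - t) by rewrite !mulr_ge0// ltW.
apply: (@le_trans _ _ (N * N * N * C * hnorm (s - t))); last by lra.
apply: dist_le => // u v uA vB.
have [s0|s0] := eqVneq (rsubmx s) 0.
  have [_ [d d0 dP]] := on_Y s sr Ss s0.
  (* Near [s] the section contains [Yspace], so [s + t' u] lies in it for small [t'] and [u] is
     tangent to the section; hence [hdot u v = 0]. *)
  have uB : u \in B.
    case: tB => m [f [Sf ->]]; have [_ [U [_ Us fU _ _]]] := Sf.
    rewrite diff_jacobianE; last by case: (fU s Us).
    apply: secant_kernel Sf _ => e e0.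
    exists (d / (l1norm u + 1)) => [|t' /andP[t'0]].
      by rewrite divr_gt0// ltr_wpDl ?l1norm_ge0.
    rewrite ltr_pdivlMr ?ltr_wpDl ?l1norm_ge0// => t'd.
    exists (s + t'%:C *: u); last by rewrite subrr l1norm0 mulr_ge0// ltW.
    apply: dP; last by rewrite linearD linearZ /= s0 (AY u uA) scaler0 addr0.
    by rewrite addrAC subrr add0r l1normZ normc_real gtr0_norm//; lra.
  rewrite (vB u uB) ComplexField.Normc.normc0.
  by rewrite mulr_ge0// mulr_ge0 ?hnorm_ge0.
have [m [g [Xg [f [Sf Jf]]]]] := off_Y s sr Ss s0.
have [c cE] := normal_vector_rowspace (fun b bJ => vB b (proj2 (tangent_spaceP Sf tB b) bJ)).
(* A normal of the section has the form $a\,dg + b\,l$ with [w0] fixed, to which the estimate on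
   $c_Y$ applies. *)
have vE : map_mx (@conjc R) v =
    lsubmx c *m ('J g s)^T + rsubmx c 0 0 *: l^T.
  rewrite cE Jf -{1}[c]hsubmxK tr_row_mx mul_row_col.
  by rewrite {1}[rsubmx c]mx11_scalar mul_scalar_mx.
have [_] := est _ _ _ _ (lsubmx c) (rsubmx c 0 0) sr w0r s0 Ss.2 Xg.
rewrite -/l -vE l1norm_conj => vY.
(* As [u] is tangent to [Yspace], only the $y$ components of [v] enter. *)
have uvE : hdot u v = (lsubmx u *m (lsubmx (map_mx (@conjc R) v))^T) 0 0.
  rewrite hdotE -{1}[u]hsubmxK (AY u uA) -{1}[map_mx _ v]hsubmxK.
  by rewrite tr_row_mx mul_row_col mul0mx addr0.
have h1 : normc (hdot u v) <= l1norm u * (C * l1norm (rsubmx s) * l1norm v).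
  rewrite uvE; apply: le_trans (normc_le_l1norm _ 0 0) _.
  apply: le_trans (l1normM _ _) _; rewrite l1norm_tr.
  apply: ler_pM; rewrite ?l1norm_ge0//.
  by rewrite (l1norm_split u) lerDl l1norm_ge0.
apply: le_trans h1 _.
(* The $z$ part of [t] is 0, so [s] and [s - t] have the same $z$ part. *)
have hs : l1norm (rsubmx s) <= N * hnorm (s - t).
  apply: le_trans (l1norm_le_hnorm _).
  by rewrite (l1norm_split (s - t)) (linearB rsubmx) /= tY subr0 lerDr l1norm_ge0.
have hu : l1norm u <= N * hnorm u := l1norm_le_hnorm u.
have hv : l1norm v <= N * hnorm v := l1norm_le_hnorm v.
apply: (@le_trans _ _ (N * hnorm u * (C * (N * hnorm (s - t)) * (N * hnorm v)))).
  apply: ler_pM => //; rewrite ?l1norm_ge0//.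
    by rewrite !mulr_ge0 ?l1norm_ge0// ltW.
  apply: ler_pM => //; rewrite ?l1norm_ge0//.
    by rewrite !mulr_ge0 ?l1norm_ge0// ltW.
  by rewrite ler_wpM2l// ltW.
by lra.
Qed.
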